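(* Let $v_m\ge0$ be such that for all $i$, $M(U_i,\xi)>0\Rightarrow|\xi|\le v_m$ (equivalently $|u_i|+\sqrt{2gh_i}\le v_m$), and assume the CFL condition $\sigma_iv_m\le\beta<1$ for all $i$, where $\beta$ is a given constant. Let $U_i^{n+1}=(h_i^{n+1},h_i^{n+1}u_i^{n+1})^T$ be given by the hydrostatic reconstruction (HR) scheme with the kinetic homogeneous numerical flux. Then $$\begin{aligned}\eta(U_i^{n+1})+gz_ih_i^{n+1}\le{}&\eta(U_i)+gz_ih_i-\sigma_i\bigl(\widetilde G_{i+1/2}-\widetilde G_{i-1/2}\bigr)\\&+C_\beta(\sigma_iv_m)^2\Bigl(g(h_i-h_{i+1/2-})^2+g(h_i-h_{i-1/2+})^2\Bigr),\end{aligned}$$ where $C_\beta\ge0$ depends only on $\beta$ and $$\widetilde G_{i+1/2}=\int_{\xi<0}\xi H(M_{i+1/2+},\xi,z_{i+1/2})\,d\xi+\int_{\xi>0}\xi H(M_{i+1/2-},\xi,z_{i+1/2})\,d\xi,$$ or equivalently $\widetilde G_{i+1/2}=\mathcal G(U_{i+1/2-},U_{i+1/2+})+gz_{i+1/2}\mathcal F^0(U_{i+1/2-},U_{i+1/2+})$. This is the discrete entropy inequality associated to the HR scheme with kinetic homogeneous numerical flux. Moreover $$0\le h_i-h_{i+1/2-}\le|z_{i+1}-z_i|,\qquad 0\le h_i-h_{i-1/2+}\le|z_i-z_{i-1}|.$$ Consequently, the quadratic error term proportional to $C_\beta$ in the right-hand side of the discrete entropy inequality (that inequality being divided by $\Delta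 t^n$ to be consistent with the continuous entropy inequality) has the following key properties: it vanishes identically when $z=\mathrm{cst}$ (no topography) or when $\sigma_i\to0$ (semi-discrete limit), and as soon as the topography is Lipschitz continuous, it tends to zero strongly when the grid size tends to $0$ (consistency with the continuous entropy inequality), even if the solution contains shocks.
   Context: The Saint-Venant system, for the water height $h(t,x)\ge0$ and velocity $u(t,x)\in\mathbb R$ with topography $z(x)$ and gravity constant $g>0$, is $\partial_th+\partial_x(hu)=0$, $\partial_t(hu)+\partial_x(hu^2+g\frac{h^2}2)+gh\,\partial_xz=0$. Its continuous entropy inequality is $\partial_t\bigl(h\frac{u^2}2+g\frac{h^2}2+ghz\bigr)+\partial_x\bigl((h\frac{u^2}2+gh^2+ghz)u\bigr)\le0$. The grid is $\cdots<x_{i-1/2}<x_{i+1/2}<\cdots$ ($i\in\mathbb Z$), with cells $C_i=(x_{i-1/2},x_{i+1/2})$ of lengths $\Delta x_i=x_{i+1/2}-x_{i-1/2}$; $\Delta t^n=t^{n+1}-t^n$ is the timestep and $\sigma_i=\Delta t^n/\Delta x_i$. $U_i=(h_i,h_iu_i)^T$, with $h_i\ge0$, is the discrete state at time $t^n$ and $z_i$ is the discretized topography in cell $C_i$. Entropy: $\eta(U)=h\frac{u^2}2+g\frac{h^2}2$ for $U=(h,hu)^T$. Kinetic Maxwellian: $M(U,\xi)=\frac1{g\pi}\bigl(2gh-(\xi-u)^2\bigr)_+^{1/2}$ for $\xi\in\mathbb R$, with $x_+=\max(0,x)$. Kinetic entropies, for $f\ge0$: $H_0(f,\xi)=\frac{\xi^2}2f+\frac{g^2\pi^2}6f^3$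 and $H(f,\xi,z)=H_0(f,\xi)+gzf$. Hydrostatic reconstruction: $z_{i+1/2}=\max(z_i,z_{i+1})$, $h_{i+1/2-}=(h_i+z_i-z_{i+1/2})_+$, $h_{i+1/2+}=(h_{i+1}+z_{i+1}-z_{i+1/2})_+$, $U_{i+1/2-}=(h_{i+1/2-},h_{i+1/2-}u_i)^T$ (with velocity $u_i$), $U_{i+1/2+}=(h_{i+1/2+},h_{i+1/2+}u_{i+1})^T$ (with velocity $u_{i+1}$), and $M_{i+1/2\pm}=M(U_{i+1/2\pm},\xi)$. HR scheme with kinetic homogeneous numerical flux: $U_i^{n+1}=U_i-\sigma_i(F_{i+1/2-}-F_{i-1/2+})$, with $$F_{i+1/2-}=\mathcal F(U_{i+1/2-},U_{i+1/2+})+\begin{pmatrix}0\\ g\frac{h_i^2}2-g\frac{h_{i+1/2-}^2}2\end{pmatrix},\quad F_{i+1/2+}=\mathcal F(U_{i+1/2-},U_{i+1/2+})+\begin{pmatrix}0\\ g\frac{h_{i+1}^2}2-g\frac{h_{i+1/2+}^2}2\end{pmatrix},$$ $$\mathcal F(U_l,U_r)=\int_{\xi>0}\xi\begin{pmatrix}1\\ \xi\end{pmatrix}M(U_l,\xi)\,d\xi+\int_{\xi<0}\xi\begin{pmatrix}1\\ \xi\end{pmatrix}M(U_r,\xi)\,d\xi.$$ $\mathcal F^0$ denotes the first component of $\mathcal F$, and $\mathcal G(U_l,U_r)=\int_{\xi>0}\xi H_0(M(U_l,\xi),\xi)\,d\xi+\int_{\xi<0}\xi H_0(M(U_r,\xi),\xi)\,d\xi$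 is the numerical entropy flux of the scheme without topography. *)

(* Defs.v *)
From HB Require Import structures.
From mathcomp Require Import all_boot all_order all_algebra.
From mathcomp Require Import all_classical all_reals all_analysis.

Set Implicit Arguments.
Unset Strict Implicit.
Unset Printing Implicit Defensive.

Import Order.TTheory GRing.Theory Num.Theory.
Import numFieldNormedType.Exports.

Local Open Scope classical_set_scope.
Local Open Scope ring_scope.

(* The state U = (h, h u), recorded by its height h and velocity u.  The
   velocity of a dry state (h = 0) is irrelevant to every quantity below. *)
Record state (R : Type) := State { height : R; velocity : R }.

(* Half-integer indices: a quantity at the interface i + 1/2 is indexed by i.
   So x i stands for x_{i+1/2}, the cell C_i is ]x (i - 1), x i[, and the
   interface i - 1/2 has index i - 1. *)

Section SaintVenant.
Context {R : realType}.
Implicit Types (g dt vm C xi f zeta : R) (V Ul Ur : state R).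
Implicit Types (x z : int -> R) (U : int -> state R) (i : int).

Local Notation mu := (@lebesgue_measure R).

Definition discharge V : R := height V * velocity V.

Definition entropy g V : R :=
  height V * (velocity V ^+ 2 / 2) + g * (height V ^+ 2 / 2).

Definition maxwellian g V xi : R :=
  (g * pi)^-1 *
  Num.sqrt (Num.max 0 (2 * g * height V - (xi - velocity V) ^+ 2)).

Definition kin_entropy0 g f xi : R :=
  xi ^+ 2 / 2 * f + g ^+ 2 * pi ^+ 2 / 6 * f ^+ 3.

Definition kin_entropy g f xi zeta : R := kin_entropy0 g f xi + g * zeta * f.

(* The two components of the kinetic flux F(Ul, Ur). *)
Definition mass_flux g Ul Ur : R :=
  \int[mu]_(xi in `]0, +oo[) (xi * maxwellian g Ul xi) +
  \int[mu]_(xi in `]-oo, 0[) (xi * maxwellian g Ur xi).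

Definition momentum_flux g Ul Ur : R :=
  \int[mu]_(xi in `]0, +oo[) (xi * (xi * maxwellian g Ul xi)) +
  \int[mu]_(xi in `]-oo, 0[) (xi * (xi * maxwellian g Ur xi)).

Definition entropy_flux g Ul Ur : R :=
  \int[mu]_(xi in `]0, +oo[) (xi * kin_entropy0 g (maxwellian g Ul xi) xi) +
  \int[mu]_(xi in `]-oo, 0[) (xi * kin_entropy0 g (maxwellian g Ur xi) xi).

Definition zhalf z i : R := Num.max (z i) (z (i + 1)).

(* h_{i+1/2-} and h_{i+1/2+} *)
Definition hminus z U i : R :=
  Num.max 0 (height (U i) + z i - zhalf z i).
Definition hplus z U i : R :=
  Num.max 0 (height (U (i + 1)) + z (i + 1) - zhalf z i).

(* U_{i+1/2-} and U_{i+1/2+} *)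
Definition Uminus z U i : state R := State (hminus z U i) (velocity (U i)).
Definition Uplus z U i : state R := State (hplus z U i) (velocity (U (i + 1))).

(* First component of both F_{i+1/2-} and F_{i+1/2+} *)
Definition hr_mass_flux g z U i : R := mass_flux g (Uminus z U i) (Uplus z U i).

(* Second components of F_{i+1/2-} and F_{i+1/2+} *)
Definition hr_momentum_flux_minus g z U i : R :=
  momentum_flux g (Uminus z U i) (Uplus z U i) +
  (g * (height (U i) ^+ 2 / 2) - g * (hminus z U i ^+ 2 / 2)).
Definition hr_momentum_flux_plus g z U i : R :=
  momentum_flux g (Uminus z U i) (Uplus z U i) +
  (g * (height (U (i + 1)) ^+ 2 / 2) - g * (hplus z U i ^+ 2 / 2)).

Definition dx x i : R := x i - x (i - 1).

Definition sigma x dt i : R := dt / dx x i.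

(* U1 is the state at time t^{n+1} given by the HR scheme. *)
Definition hr_scheme g x dt z U (U1 : int -> state R) : Prop := forall i,
  height (U1 i) = height (U i)
    - sigma x dt i * (hr_mass_flux g z U i - hr_mass_flux g z U (i - 1)) /\
  discharge (U1 i) = discharge (U i)
    - sigma x dt i *
      (hr_momentum_flux_minus g z U i - hr_momentum_flux_plus g z U (i - 1)).

Definition Gtilde g z U i : R :=
  \int[mu]_(xi in `]-oo, 0[)
    (xi * kin_entropy g (maxwellian g (Uplus z U i) xi) xi (zhalf z i)) +
  \int[mu]_(xi in `]0, +oo[)
    (xi * kin_entropy g (maxwellian g (Uminus z U i) xi) xi (zhalf z i)).

Definition quadratic_error C g vm x dt z U i : R :=
  C * (sigma x dt i * vm) ^+ 2 *
  (g * (height (U i) - hminus z U i) ^+ 2 +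
   g * (height (U i) - hplus z U (i - 1)) ^+ 2).

Record hr_setting (beta g vm : R) (x : int -> R) (dt : R)
    (U : int -> state R) : Prop := HRSetting {
  gravity_gt0 : 0 < g;
  speed_bound_ge0 : 0 <= vm;
  grid_increasing : forall i, x (i - 1) < x i;
  timestep_gt0 : 0 < dt;
  height_ge0 : forall i, 0 <= height (U i);
  maxwellian_support : forall i xi, 0 < maxwellian g (U i) xi -> `|xi| <= vm;
  cfl : forall i, sigma x dt i * vm <= beta }.

Definition mesh_size x : \bar R := ereal_sup (range (fun i => (dx x i)%:E)).

(* By the intermediate value theorem, for a continuous zf this covers point
   values as well as cell averages. *)
Definition discretizes (zf : R -> R) x z : Prop :=
  forall i, exists2 y, x (i - 1) <= y <= x i & z i = zf y.

(* The piecewise constant function with value e i in C_i.  At each point at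
   most one term of the sum is nonzero, the cells being pairwise disjoint. *)
Definition piecewise_constant x (e : int -> R) (y : R) : R :=
  \sum_(i \in [set: int]) (e i * \1_(`]x (i - 1), x i[) y).

Definition L1_norm (a b : R) (f : R -> R) : \bar R :=
  (\int[mu]_(y in `[a, b]) `|f y|%:E)%E.

End SaintVenant.

(* Main.v *)
Require Import Defs.
From HB Require Import structures.
From mathcomp Require Import all_boot all_order all_algebra.
From mathcomp Require Import all_classical all_reals all_analysis.
From mathcomp Require Import ring lra zify.

Set Implicit Arguments.
Unset Strict Implicit.
Unset Printing Implicit Defensive.

Import Order.TTheory GRing.Theory Num.Theory.
Import numFieldNormedType.Exports.

Local Open Scope classical_set_scope.
Local Open Scope ring_scope.

(** Fix a cell i and a particle velocity xi.  Let m, p, q be the values at xi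
    of the Maxwellians of U_i, U_{i+1/2-} and U_{i-1/2+}, which share the
    velocity u and satisfy p, q <= m, and let r, l be those of U_{i+1/2+} and
    U_{i-1/2-}, which come from the neighbouring cells.  The scheme computes
    the moments of order 0 and 1 in xi of
      f = m - sig (xi^+ p - xi^- r - xi^+ l + xi^- q + (xi - u) (q - p)),
    which is nonnegative under the CFL condition.  Among the nonnegative
    densities with given moments the Maxwellian has the least kinetic entropy
    (entropy_minimization), so the entropy of the new state is at most the
    integral of H(f, xi, z_i), and it remains to bound the latter for each xi.

    For xi < 0 and s = sig |xi| one has f = m + s (r - p) + sig u (q - p); the
    case xi > 0 is its mirror image.  Since H is cubic in f, H(f) is its first
    order expansion at m plus a remainder.  The remainder contains (r - p)^2,
    which is not small across a shock; but upwinding produces the dissipation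
    s (H0(r) - H0(p) - H0'(p) (r - p)), which dominates this term because
    s <= beta < 1.  What is left over is of order (sig v)^2 and vanishes with
    m - p and m - q (cubic_increment): this is the quadratic error.

    The first order terms fit together because of the hydrostatic
    reconstruction.  The slope H0'(m) - H0'(p) is at most g (h_i - h_{i+1/2-}),
    with equality where p > 0, hence at most g (z_{i+1/2} - z_i), and this is
    what turns z_i into z_{i+1/2} in the flux (kin_entropy_increment).  The
    only remaining terms are linear in the densities, and their integral
    vanishes by the well-balanced property
    h_{i+1/2-} (h_{i+1/2-} + z_{i+1/2} - h_i - z_i) = 0 (intR_well_balanced).
    Finally the integral of m (m - p)^2 is controlled by (h_i - h_{i+1/2-})^2,
    because (m + p) (m - p) is at most a multiple of h_i - h_{i+1/2-}
    (intR_reconstruction_error).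

    For the consistency statement, the error rate in a cell times the length
    of the cell is at most a constant times the mesh size times the length of
    the cell and its neighbours.  The sum over the cells meeting [a, b]
    telescopes, and the mesh size remains as a factor
    (L1_norm_piecewise_constant_le). *)

(** * Integration of compactly supported continuous functions *)

Section CompactlySupported.
Context {R : realType}.
Implicit Types (f g F : R -> R) (a b c k x : R).
Local Notation mu := (@lebesgue_measure R).

Lemma continuousD f g : continuous f -> continuous g ->
  continuous (fun x => f x + g x).
Proof. by move=> cf cg x; apply: cvgD; [exact: cf|exact: cg]. Qed.

Lemma continuousB f g : continuous f -> continuous g ->
  continuous (fun x => f x - g x).
Proof. by move=> cf cg x; apply: cvgB; [exact: cf|exact: cg]. Qed.

Lemma continuousM f g : continuous f -> continuous g ->
  continuous (fun x => f x * g x).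
Proof. by move=> cf cg x; apply: cvgM; [exact: cf|exact: cg]. Qed.

Lemma continuousN f : continuous f -> continuous (fun x => - f x).
Proof. by move=> cf x; apply: cvgN; exact: cf. Qed.

Lemma continuousX f n : continuous f -> continuous (fun x => f x ^+ n).
Proof.
move=> cf x; apply: (@continuous_comp _ _ _ f (fun y => y ^+ n)); first exact: cf.
exact: exprn_continuous.
Qed.

Lemma continuous_maxr f g : continuous f -> continuous g ->
  continuous (fun x => Num.max (f x) (g x)).
Proof. by move=> cf cg x; apply: continuous_max; [exact: cf|exact: cg]. Qed.

Lemma continuous_sqrt_comp f : continuous f ->
  continuous (fun x => Num.sqrt (f x)).
Proof.
move=> cf x; apply: (@continuous_comp _ _ _ f (@Num.sqrt R)); first exact: cf.
exact: sqrt_continuous.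
Qed.

Lemma continuous_idr : continuous (fun x : R => x).
Proof. by move=> x; exact: cvg_id. Qed.

Lemma continuous_cstr k : continuous (fun _ : R => k).
Proof. by move=> x; exact: cvg_cst. Qed.

(** All the densities below are continuous with bounded support; on this class
    the integral is linear and monotone without further side conditions. *)
Definition csupp f := continuous f /\ exists k, forall x, k < `|x| -> f x = 0.

Lemma csupp_continuous f : csupp f -> continuous f.
Proof. by case. Qed.

Lemma csuppD f g : csupp f -> csupp g -> csupp (fun x => f x + g x).
Proof.
move=> [cf [k fk]] [cg [l gl]]; split; first exact: continuousD.
exists (Num.max k l) => x; rewrite gt_max => /andP[kx lx].
by rewrite fk// gl// addr0.
Qed.

Lemma csuppMl f g : continuous f -> csupp g -> csupp (fun x => f x * g x).
Proof.
move=> cf [cg [l gl]]; split; first exact: continuousM.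
by exists l => x lx; rewrite gl// mulr0.
Qed.

Lemma csuppN f : csupp f -> csupp (fun x => - f x).
Proof.
move=> [cf [k fk]]; split; first exact: continuousN.
by exists k => x kx; rewrite fk// oppr0.
Qed.

Lemma csuppB f g : csupp f -> csupp g -> csupp (fun x => f x - g x).
Proof. by move=> sf /csuppN; exact: csuppD. Qed.

Lemma csuppX f n : csupp f -> csupp (fun x => f x ^+ n.+1).
Proof.
move=> sf; have -> : (fun x => f x ^+ n.+1) = (fun x => f x ^+ n * f x).
  by apply/funext => x; rewrite exprSr.
by apply: csuppMl => //; apply: continuousX; exact: csupp_continuous.
Qed.

Lemma csupp_integrable f (D : set R) : csupp f -> measurable D ->
  mu.-integrable D (EFin \o f).
Proof.
move=> [cf [k fk]] mD.
apply: (@integrableS _ _ _ mu setT) => //.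
have mK : measurable (`[- k, k] : set (measurableTypeR R)) by exact: measurable_itv.
have : mu.-integrable `[- k, k] (EFin \o f).
  apply: continuous_compact_integrable; first exact: segment_compact.
  exact: continuous_subspaceT.
move=> /(integrable_mkcond _ mK); apply: eq_integrable => // x _.
rewrite patchE /=; case: ifPn => // /negP xk.
rewrite fk//; rewrite ltNge; apply: contra_notN xk.
by rewrite ler_norml => h; apply/mem_set; rewrite /= in_itv.
Qed.

Definition intR f : R := \int[mu]_x f x.

Lemma intRD f g : csupp f -> csupp g -> intR (fun x => f x + g x) = intR f + intR g.
Proof. by move=> sf sg; apply: RintegralD => //; exact: csupp_integrable. Qed.

Lemma intRB f g : csupp f -> csupp g -> intR (fun x => f x - g x) = intR f - intR g.
Proof. by move=> sf sg; apply: RintegralB => //; exact: csupp_integrable. Qed.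

Lemma intRZ f k : csupp f -> intR (fun x => k * f x) = k * intR f.
Proof. by move=> sf; apply: RintegralZl => //; exact: csupp_integrable. Qed.

Lemma intR_eq f g : f =1 g -> intR f = intR g.
Proof. by move=> fg; apply: eq_Rintegral => x _; exact: fg. Qed.

Lemma intR_le f g : csupp f -> csupp g -> (forall x, f x <= g x) -> intR f <= intR g.
Proof.
move=> sf sg fg; apply: le_Rintegral => //; exact: csupp_integrable.
Qed.

Lemma intR_ge0 f : (forall x, 0 <= f x) -> 0 <= intR f.
Proof. by move=> f0; apply: Rintegral_ge0 => x _. Qed.

(** A half-line flux weights each particle by its velocity, so the weight
    vanishes at 0 and the two half-lines glue into one continuous integrand. *)
Lemma intR_halves f g : csupp f -> csupp g ->
  \int[mu]_(x in `]0, +oo[) (x * f x) + \int[mu]_(x in `]-oo, 0[) (x * g x) =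
  intR (fun x => Num.max x 0 * f x - Num.max (- x) 0 * g x).
Proof.
move=> sf sg; rewrite intRB.
- rewrite Rintegral_mkcond [X in _ + X]Rintegral_mkcond -[RHS]addrC.
  rewrite [LHS]addrC; congr (_ + _).
  + rewrite -mulN1r -intRZ; last first.
      by apply: csuppMl sg; apply: continuous_maxr;
        [apply: continuousN; exact: continuous_idr|exact: continuous_cstr].
    apply: intR_eq => x; rewrite patchE; case: ifPn.
      rewrite inE/= in_itv/= => x0.
      by rewrite max_l ?oppr_ge0 ?ltW// mulN1r mulNr opprK.
    move=> /negP xn; have x0 : 0 <= x.
      by rewrite leNgt; apply: contra_notN xn => h; apply/mem_set; rewrite /= in_itv.
    by rewrite max_r ?oppr_le0// mul0r mulr0.
  + apply: intR_eq => x; rewrite patchE; case: ifPn.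
      by rewrite inE/= in_itv/= andbT => x0; rewrite max_l ?ltW.
    move=> /negP xn; have x0 : x <= 0.
      rewrite leNgt; apply: contra_notN xn => h; apply/mem_set.
      by rewrite /= in_itv/= andbT.
    by rewrite max_r// mul0r.
- by apply: csuppMl sf; apply: continuous_maxr;
    [exact: continuous_idr|exact: continuous_cstr].
- by apply: csuppMl sg; apply: continuous_maxr;
    [apply: continuousN; exact: continuous_idr|exact: continuous_cstr].
Qed.

(** At the ends [F] is only required to be continuous: the square roots below
    are not differentiable there. *)
Lemma intR_FTC f F a b : a < b -> continuous f -> continuous F ->
  (forall x, ~~ (a < x < b) -> f x = 0) ->
  (forall x, a < x < b -> is_derive x 1 F (f x)) -> intR f = F b - F a.
Proof.
move=> ab cf cF f0 dF; rewrite /intR.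
transitivity (\int[mu]_(x in `[a, b]) f x).
  rewrite [RHS]Rintegral_mkcond; apply: eq_Rintegral => x _.
  rewrite patchE; case: ifPn => // /negP xn; apply: f0; apply/negP => /andP[ax xb].
  by apply: xn; apply/mem_set; rewrite /= in_itv/= !ltW.
rewrite /Rintegral (@continuous_FTC2 _ _ F)//.
- exact: continuous_subspaceT.
- split.
  + by move=> x; rewrite in_itv/= => xab; have [] := dF x xab.
  + by apply: cvg_at_right_filter; exact: cF.
  + by apply: cvg_at_left_filter; exact: cF.
- move=> x; rewrite in_itv/= => xab; rewrite derive1E.
  by have /@derive_val -> := dF x xab.
Qed.

End CompactlySupported.

(** Syntax-directed, because unification would unfold the integrands when
    looking for sums and products. *)
Ltac solve_continuous := lazymatch goal with
  | |- continuous ?F => lazymatch F with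
    | (fun x => x) => exact: continuous_idr
    | (fun _ => ?k) => exact: continuous_cstr
    | (fun x => - @?f x) => refine (@continuousN _ f _); solve_continuous
    | (fun x => @?f x + @?g x) =>
        refine (@continuousD _ f g _ _); solve_continuous
    | (fun x => @?f x * @?g x) =>
        refine (@continuousM _ f g _ _); solve_continuous
    | (fun x => @?f x ^+ _) => refine (@continuousX _ f _ _); solve_continuous
    | (fun x => Num.max (@?f x) (@?g x)) =>
        refine (@continuous_maxr _ f g _ _); solve_continuous
    | _ => apply: csupp_continuous; solve_csupp
    end
  end
with solve_csupp := lazymatch goal with
  | |- csupp ?F => lazymatch F with
    | (fun x => - @?f x) => refine (@csuppN _ f _); solve_csupp
    | (fun x => @?f x + @?g x) => refine (@csuppD _ f g _ _); solve_csupp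
    | (fun x => @?f x * @?g x) =>
        refine (@csuppMl _ f g _ _); [solve_continuous | solve_csupp]
    | (fun x => @?f x ^+ _) => refine (@csuppX _ f _ _); solve_csupp
    | _ => solve [assumption | auto]
    end
  end.

(** * Moments of the semicircle *)

Section Semicircle.
Context {R : realType}.
Implicit Types (k u x : R) (Q : R -> R).

Definition semicircle k u x : R := Num.sqrt (k - (x - u) ^+ 2).

Lemma continuous_centered u : continuous (fun x : R => x - u).
Proof. by apply: continuousB; [exact: continuous_idr|exact: continuous_cstr]. Qed.

Lemma continuous_semicircle k u : continuous (semicircle k u).
Proof.
apply: continuous_sqrt_comp; apply: continuousB; first exact: continuous_cstr.
by apply: continuousX; exact: continuous_centered.
Qed.

Lemma semicircle_out k u x : k <= (x - u) ^+ 2 -> semicircle k u x = 0.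
Proof. by move=> h; rewrite /semicircle ler0_sqrtr// subr_le0. Qed.

Lemma csupp_semicircle k u : csupp (semicircle k u).
Proof.
split; first exact: continuous_semicircle.
exists (`|u| + `|k| + 1) => x hx; apply: semicircle_out.
have h : `|k| + 1 <= `|x - u| by have := lerB_dist x u; lra.
rewrite -real_normK ?num_real//; apply: (le_trans (ler_norm k)).
by have := normr_ge0 k; nra.
Qed.

Lemma semicircle_sqr k u x : (x - u) ^+ 2 <= k ->
  semicircle k u x ^+ 2 = k - (x - u) ^+ 2.
Proof. by move=> h; rewrite sqr_sqrtr// subr_ge0. Qed.

Lemma is_derive_semicircle k u x : (x - u) ^+ 2 < k ->
  is_derive x 1 (semicircle k u) (- (x - u) / semicircle k u x).
Proof.
move=> h.
have d1 : is_derive x 1 (fun y : R => y - u) 1.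
  by apply: is_derive_eq; rewrite subr0.
have d2 : is_derive x 1 (fun y : R => k - (y - u) ^+ 2) (- (2 * (x - u))).
  apply: (is_derive_eq (is_deriveB (is_derive_cst k x 1) (is_deriveX 2 d1))).
  by rewrite sub0r /GRing.scale/= mulr1 expr1.
have d3 : is_derive (k - (x - u) ^+ 2) 1 Num.sqrt
    (2 * Num.sqrt (k - (x - u) ^+ 2))^-1.
  by apply: is_derive1_sqrt; rewrite subr_gt0.
have dS : is_derive x 1 (semicircle k u) _ :=
  @is_derive1_comp R Num.sqrt (fun y => k - (y - u) ^+ 2) x _ _ d3 d2.
apply: (is_derive_eq dS).
rewrite -/(semicircle k u x).
have S0 : semicircle k u x != 0 by rewrite gt_eqF// sqrtr_gt0 subr_gt0.
by field.
Qed.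

Lemma semicircle_gt0 k u x : (x - u) ^+ 2 < k -> 0 < semicircle k u x.
Proof. by move=> h; rewrite sqrtr_gt0 subr_gt0. Qed.

Lemma itv_semicircle k u x : 0 < k ->
  (u - Num.sqrt k < x < u + Num.sqrt k) = ((x - u) ^+ 2 < k).
Proof.
move=> k0; rewrite -{3}(sqr_sqrtr (ltW k0)).
rewrite -[in RHS]real_normK ?num_real// ltr_pXn2r ?nnegrE ?sqrtr_ge0//.
by rewrite ltr_distl.
Qed.

Lemma semicircle_itv_out k u x : 0 < k ->
  ~~ (u - Num.sqrt k < x < u + Num.sqrt k) -> semicircle k u x = 0.
Proof. by move=> k0; rewrite itv_semicircle// -leNgt; exact: semicircle_out. Qed.

(** The integrand is the derivative of [Q w * S ^ 3] with [w = x - u] and [S]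
    the semicircle, and [S] vanishes at both ends.  With [Q] a monomial this
    is a recursion between moments. *)
Lemma intR_semicircle_parts k u Q dQ : 0 < k -> continuous dQ ->
  (forall w : R, is_derive w 1 Q (dQ w)) ->
  intR (fun x => (dQ (x - u) * (k - (x - u) ^+ 2) - 3 * (x - u) * Q (x - u)) *
                semicircle k u x) = 0.
Proof.
move=> k0 cdQ dQQ.
have cQ : continuous Q.
  move=> w; apply: differentiable_continuous; apply/derivable1_diffP.
  by have [] := dQQ w.
have cc (f : R -> R) : continuous f -> continuous (fun x : R => f (x - u)).
  move=> cf x; apply: (@continuous_comp _ _ _ (fun x : R => x - u) f).
    exact: continuous_centered.
  exact: cf.
pose F x := Q (x - u) * semicircle k u x ^+ 3.
have s0 : 0 < Num.sqrt k by rewrite sqrtr_gt0.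
transitivity (F (u + Num.sqrt k) - F (u - Num.sqrt k)); last first.
  by rewrite /F !semicircle_itv_out ?ltxx ?andbF// expr0n/= !mulr0 subrr.
apply: intR_FTC.
- by lra.
- apply: continuousM; last exact: continuous_semicircle.
  apply: continuousB; apply: continuousM.
  + exact: cc.
  + apply: continuousB; first exact: continuous_cstr.
    by apply: continuousX; exact: continuous_centered.
  + apply: continuousM; first exact: continuous_cstr.
    exact: continuous_centered.
  + exact: cc.
- by apply: continuousM; [exact: cc|apply: continuousX; exact: continuous_semicircle].
- by move=> x xn; rewrite semicircle_itv_out// mulr0.
- move=> x; rewrite (itv_semicircle u x k0) => xk.
  have dS := is_derive_semicircle xk.
  have d1 : is_derive x 1 (fun y : R => y - u) 1.
    by apply: is_derive_eq; rewrite subr0.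
  have dQu := @is_derive1_comp R Q (fun y => y - u) x _ _ (dQQ (x - u)) d1.
  have dS3 := is_deriveX 3 dS.
  have dF : is_derive x 1 F _ := is_deriveM dQu dS3.
  apply: (is_derive_eq dF).
  have Sx := semicircle_gt0 xk; have S0 := lt0r_neq0 Sx.
  have S2 := semicircle_sqr (ltW xk).
  rewrite -S2 /GRing.scale/= fctE.
  by field.
Qed.

Lemma intR_semicircle k u : 0 < k -> intR (semicircle k u) = pi / 2 * k.
Proof.
move=> k0.
have s0 : 0 < Num.sqrt k by rewrite sqrtr_gt0.
have s2 : Num.sqrt k ^+ 2 = k by rewrite sqr_sqrtr// ltW.
pose r := Num.sqrt k.
pose S := semicircle k u.
(* 2 atan (w / (r + S)) is the angle asin (w / r), in a form that is regular
   up to the ends of the interval *)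
have rS0 x : r + S x != 0 by rewrite gt_eqF// ltr_wpDr// sqrtr_ge0.
pose G x := (x - u) / (r + S x).
pose F x := 2^-1 * ((x - u) * S x) + k * atan (G x).
have cG : continuous G.
  move=> x; apply: cvgM; first exact: continuous_centered.
  apply: cvgV; first exact: rS0.
  exact: (continuousD (@continuous_cstr _ r) (@continuous_semicircle k u)).
have cF : continuous F.
  apply: continuousD; apply: continuousM; try exact: continuous_cstr.
    by apply: continuousM; [exact: continuous_centered|exact: continuous_semicircle].
  move=> x; apply: (@continuous_comp _ _ _ G (@atan R)); first exact: cG.
  exact: continuous_atan.
transitivity (F (u + r) - F (u - r)); last first.
  rewrite /F /G /S !semicircle_itv_out ?ltxx ?andbF// !addr0 !mulr0 !add0r.
  have -> : (u + r - u) / r = 1 by rewrite (_ : _ - u = r) ?divff ?lt0r_neq0//; ring.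
  have -> : (u - r - u) / r = - 1.
    by rewrite (_ : _ - u = - r) ?mulNr ?divff ?lt0r_neq0//; ring.
  by rewrite atanN atan1; field.
apply: intR_FTC.
- by rewrite /r; lra.
- exact: continuous_semicircle.
- exact: cF.
- by move=> x; exact: semicircle_itv_out.
- move=> x; rewrite (itv_semicircle u x k0) => xk.
  have dS : is_derive x 1 S _ := is_derive_semicircle xk.
  have d1 : is_derive x 1 (fun y : R => y - u) 1.
    by apply: is_derive_eq; rewrite subr0.
  have dr : is_derive x 1 (fun y => r + S y) (0 + - (x - u) / S x).
    by apply: is_deriveD.
  have dV : is_derive x 1 (fun y => (r + S y)^-1) _ :=
    @is_deriveV R (fun y => r + S y) x _ 1 (rS0 x) dr.
  have dG : is_derive x 1 G _ :=
    @is_deriveM R R (fun y => y - u) (fun y => (r + S y)^-1) x 1 _ _ d1 dV.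
  have dA := @is_derive1_comp R atan G x _ _ (is_derive1_atan (G x)) dG.
  have dwS := @is_deriveM R R (fun y => y - u) S x 1 _ _ d1 dS.
  have dF : is_derive x 1 F _ := is_deriveD (is_deriveZ 2^-1 dwS) (is_deriveZ k dA).
  apply: (is_derive_eq dF).
  have Sx : 0 < S x := semicircle_gt0 xk; have S0 := lt0r_neq0 Sx.
  have S2 : S x ^+ 2 = k - (x - u) ^+ 2 := semicircle_sqr (ltW xk).
  have w2 : (x - u) ^+ 2 = r ^+ 2 - S x ^+ 2 by rewrite S2 s2; ring.
  have n1 := rS0 x; have r0 : r != 0 by exact: lt0r_neq0.
  have eG : 1 + G x ^+ 2 = 2 * r / (r + S x).
    by rewrite /G expr_div_n w2; field.
  have eV : (x - u) * (- (r + S x) ^- 2 * (0 + - (x - u) / S x)) + (r + S x)^-1 =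
      r / (S x * (r + S x)).
    rewrite -[LHS]/(_ + _) (_ : _ * _ = (x - u) ^+ 2 / (S x * (r + S x) ^+ 2)).
      by rewrite w2; field; apply/andP.
    by field; apply/andP.
  rewrite /GRing.scale/= !mulr1 eV eG -/(S x) -[k]s2 -/r.
  rewrite (_ : (x - u) * _ = - (x - u) ^+ 2 / S x); last by field.
  by rewrite w2; field; rewrite S0 n1.
Qed.

End Semicircle.

(** * Moments and convexity of the Maxwellian *)

Section Maxwellian.
Context {R : realType}.
Implicit Types (g xi zeta : R) (V : state R).

Lemma maxwellianE g V xi : maxwellian g V xi =
  (g * pi)^-1 * semicircle (2 * g * height V) (velocity V) xi.
Proof.
rewrite /maxwellian /semicircle; congr (_ * _).
have [h|h] := leP 0 (2 * g * height V - (xi - velocity V) ^+ 2); first by [].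
by rewrite sqrtr0 ler0_sqrtr// ltW.
Qed.

Lemma csupp_maxwellian g V : csupp (maxwellian g V).
Proof.
rewrite (_ : maxwellian g V = fun xi => (g * pi)^-1 *
  semicircle (2 * g * height V) (velocity V) xi); last first.
  by apply/funext => xi; exact: maxwellianE.
by apply: csuppMl; [exact: continuous_cstr|exact: csupp_semicircle].
Qed.

#[local] Hint Resolve csupp_maxwellian : core.

Lemma maxwellian_ge0 g V xi : 0 < g -> 0 <= maxwellian g V xi.
Proof.
move=> g0; rewrite mulr_ge0 ?sqrtr_ge0// invr_ge0 mulr_ge0 ?pi_ge0//.
exact: ltW.
Qed.

Lemma maxwellian_sqr g V xi : 0 < g -> g ^+ 2 * pi ^+ 2 * maxwellian g V xi ^+ 2 =
  Num.max 0 (2 * g * height V - (xi - velocity V) ^+ 2).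
Proof.
move=> g0; rewrite /maxwellian exprMn sqr_sqrtr ?le_max ?lexx//.
move: (pi : R) (pi_gt0 R) => P p0; set k := Num.max _ _.
by field; rewrite !gt_eqF.
Qed.

Lemma maxwellian_gt0 g V xi : 0 < g ->
  (0 < maxwellian g V xi) = ((xi - velocity V) ^+ 2 < 2 * g * height V).
Proof.
move=> g0; have gp : 0 < (g * pi)^-1 by rewrite invr_gt0 mulr_gt0// pi_gt0.
by rewrite pmulr_rgt0// sqrtr_gt0 lt_max ltxx/= subr_gt0.
Qed.

Lemma maxwellian_dry g V : 0 < g -> height V = 0 -> maxwellian g V = cst 0.
Proof.
move=> g0 h0; apply/funext => xi; apply/eqP; rewrite eq_le maxwellian_ge0// andbT.
by rewrite leNgt maxwellian_gt0// h0 mulr0 -leNgt sqr_ge0.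
Qed.

Lemma maxwellian_le g V V' xi : 0 < g -> velocity V = velocity V' ->
  height V <= height V' -> maxwellian g V xi <= maxwellian g V' xi.
Proof.
move=> g0 uu hh; rewrite ler_pM2l ?invr_gt0 ?mulr_gt0 ?pi_gt0// ler_sqrt.
  rewrite uu ge_max !le_max lexx/= lerD2r; apply/orP; right.
  by rewrite ler_pM2l// mulr_gt0.
by rewrite le_max lexx.
Qed.

(** Reduces the cubic part of the kinetic entropy of a Maxwellian to moments
    of the Maxwellian itself. *)
Lemma maxwellian_cube g V xi : 0 < g ->
  g ^+ 2 * pi ^+ 2 * maxwellian g V xi ^+ 3 =
  (2 * g * height V - (xi - velocity V) ^+ 2) * maxwellian g V xi.
Proof.
move=> g0; rewrite (exprSr (maxwellian g V xi)) mulrA maxwellian_sqr//.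
have [h|h] := leP; first by [].
have : ~~ (0 < maxwellian g V xi) by rewrite maxwellian_gt0// -leNgt; lra.
rewrite -leNgt => M0.
by rewrite (_ : maxwellian g V xi = 0) ?mulr0//; apply/eqP;
  rewrite eq_le M0 maxwellian_ge0.
Qed.

(** Centered moments of order 0 to 3: those of odd order vanish, and the even
    ones come from the area of the semicircle and the recursion. *)
Lemma intR_maxwellian_poly g V (P : R -> R) (a0 a1 a2 a3 : R) :
  0 < g -> 0 <= height V ->
  (forall xi, P xi = a0 + a1 * (xi - velocity V) + a2 * (xi - velocity V) ^+ 2 +
                     a3 * (xi - velocity V) ^+ 3) ->
  intR (fun xi => P xi * maxwellian g V xi) =
  a0 * height V + a2 * (g * height V ^+ 2 / 2).
Proof.
move=> g0; rewrite le_eqVlt => /predU1P[/esym h0 _|h0 PE].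
  rewrite h0 expr0n/= !mulr0 mul0r mulr0 addr0.
  rewrite -(mul0r (intR (maxwellian g V))) -intRZ; last exact: csupp_maxwellian.
  by apply: intR_eq => xi; rewrite maxwellian_dry// mulr0 mul0r.
pose k := 2 * g * height V; pose u := velocity V.
have k0 : 0 < k by rewrite /k !mulr_gt0.
have cS : csupp (semicircle k u) := csupp_semicircle k u.
have d1 (w : R) : is_derive w 1 (fun _ : R => (1 : R)) 0 by exact: is_derive_cst.
have dX (w : R) : is_derive w 1 (fun x : R => x) 1 by exact: is_derive_id.
have dX2 (w : R) : is_derive w 1 (fun x : R => x ^+ 2) (2 * w).
  apply: (is_derive_eq (@is_deriveX R R id 2 w 1 1 (is_derive_id _ _))).
  by rewrite /GRing.scale/= mulr1 expr1.
have e1 := intR_semicircle_parts u k0 (@continuous_cstr _ 0) d1.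
have e2 := intR_semicircle_parts u k0 (@continuous_cstr _ 1) dX.
have c2 : continuous (fun w : R => 2 * w).
  by apply: continuousM; [exact: continuous_cstr|exact: continuous_idr].
have e3 := intR_semicircle_parts u k0 c2 dX2.
have cmon n : csupp (fun xi => (xi - u) ^+ n * semicircle k u xi).
  apply: csuppMl; first by apply: continuousX; exact: continuous_centered.
  exact: cS.
pose J n := intR (fun xi => (xi - u) ^+ n * semicircle k u xi).
have J0 : J 0%N = pi / 2 * k.
  by rewrite -(intR_semicircle u k0); apply: intR_eq => xi; rewrite mul1r.
have cmonZ n c : csupp (fun xi => c * ((xi - u) ^+ n * semicircle k u xi)).
  by apply: csuppMl; [exact: continuous_cstr|exact: cmon].
have J1 : J 1%N = 0.
  have : -3 * J 1%N = 0 by rewrite /J -intRZ// -[RHS]e1; apply: intR_eq => xi; ring.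
  by lra.
have J2 : 4 * J 2%N = k * J 0%N.
  have : k * J 0%N - 4 * J 2%N = 0.
    by rewrite /J -!intRZ// -intRB// -[RHS]e2; apply: intR_eq => xi; ring.
  by lra.
have J3 : J 3%N = 0.
  have : 2 * k * J 1%N - 5 * J 3%N = 0.
    by rewrite /J -!intRZ// -intRB// -[RHS]e3; apply: intR_eq => xi; ring.
  by rewrite J1; lra.
transitivity ((g * pi)^-1 * (a0 * J 0%N + a1 * J 1%N + a2 * J 2%N + a3 * J 3%N)).
  have c01 := csuppD (cmonZ 0%N a0) (cmonZ 1%N a1).
  have c012 := csuppD c01 (cmonZ 2%N a2).
  have c0123 := csuppD c012 (cmonZ 3%N a3).
  rewrite /J -!intRZ// -(intRD (cmonZ _ _) (cmonZ _ _)) -(intRD c01 (cmonZ _ _)).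
  rewrite -(intRD c012 (cmonZ _ _)) -(intRZ _ c0123).
  by apply: intR_eq => xi; rewrite PE maxwellianE -/k -/u; ring.
rewrite J1 J3 !mulr0 !addr0.
have -> : J 2%N = k / 4 * J 0%N by move: J2; lra.
rewrite J0 /k; move: (pi : R) (pi_gt0 R) => p p0.
by field; rewrite !gt_eqF.
Qed.

Lemma kin_entropy_maxwellian g V xi zeta : 0 < g ->
  kin_entropy g (maxwellian g V xi) xi zeta =
  (xi ^+ 2 / 2 + (2 * g * height V - (xi - velocity V) ^+ 2) / 6 + g * zeta) *
  maxwellian g V xi.
Proof.
move=> g0; rewrite /kin_entropy /kin_entropy0.
have := maxwellian_cube V xi g0; lra.
Qed.

Lemma intR_maxwellian g V : 0 < g -> 0 <= height V ->
  intR (maxwellian g V) = height V.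
Proof.
move=> g0 h0; rewrite -[RHS]addr0 -[X in X + _]mul1r -[X in _ + X](mul0r (g * height V ^+ 2 / 2)).
rewrite -(@intR_maxwellian_poly g V (fun=> 1) 1 0 0 0)//.
  by apply: intR_eq => xi; rewrite mul1r.
by move=> xi; ring.
Qed.

Lemma intR_kin_entropy g V zeta : 0 < g -> 0 <= height V ->
  intR (fun xi => kin_entropy g (maxwellian g V xi) xi zeta) =
  entropy g V + g * zeta * height V.
Proof.
move=> g0 h0; set u := velocity V; set h := height V.
transitivity ((u ^+ 2 / 2 + g * h / 3 + g * zeta) * h + 3^-1 * (g * h ^+ 2 / 2)).
  rewrite -(@intR_maxwellian_poly g V (fun xi => xi ^+ 2 / 2 +
    (2 * g * height V - (xi - velocity V) ^+ 2) / 6 + g * zeta) _ u _ 0)//.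
    by apply: intR_eq => xi; exact: kin_entropy_maxwellian.
  by move=> xi; rewrite -/u -/h; field.
by rewrite /entropy -/u -/h; field.
Qed.

Lemma intR_kin_entropy_flux g V zeta : 0 < g -> 0 <= height V ->
  intR (fun xi => xi * kin_entropy g (maxwellian g V xi) xi zeta) =
  velocity V * (height V * (velocity V ^+ 2 / 2) + g * height V ^+ 2 +
                g * zeta * height V).
Proof.
move=> g0 h0; set u := velocity V; set h := height V.
transitivity (u * (u ^+ 2 / 2 + g * h / 3 + g * zeta) * h + 4 / 3 * u * (g * h ^+ 2 / 2)).
  rewrite -(@intR_maxwellian_poly g V (fun xi => xi * (xi ^+ 2 / 2 +
    (2 * g * height V - (xi - velocity V) ^+ 2) / 6 + g * zeta)) _
    (3 * u ^+ 2 / 2 + g * h / 3 + g * zeta) _ 3^-1)//.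
    by apply: intR_eq => xi; rewrite kin_entropy_maxwellian// mulrA.
  by move=> xi; rewrite -/u -/h; field.
by field.
Qed.

End Maxwellian.

#[local] Hint Resolve csupp_maxwellian : core.

(** * The cubic inequality behind the kinetic entropy *)

Section Cubic.
Context {R : realFieldType}.
Implicit Types (b s t m p r w W c e d : R).

(** The dissipation [s w^2 (w + 3 p)], with [w = r - p], pays for the part of the
    remainder of order [(s w)^2] and leaves a fraction of order [1 - s] for the
    cross terms. *)
Lemma cubic_dissipation s p w : 0 <= s -> s <= 1 -> 0 <= p -> - p <= w ->
  s ^+ 2 * w ^+ 2 * (3 * p + s * w) + (1 - s) / 2 * (s * w ^+ 2 * (p + `|w|)) <=
  s * w ^+ 2 * (w + 3 * p).
Proof.
move=> s0 s1 p0 pw.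
have sw0 : 0 <= s * w ^+ 2 by rewrite mulr_ge0// sqr_ge0.
suff h : 0 <= (1 - s) * (3 * p + (1 + s) * w - (p + `|w|) / 2).
  rewrite -subr_ge0; have := mulr_ge0 sw0 h; set X := s * w ^+ 2.
  have -> : s ^+ 2 * w ^+ 2 = s * X by rewrite /X; ring.
  move=> H; apply: le_trans H _; rewrite le_eqVlt; apply/orP; left; apply/eqP.
  by field.
apply: mulr_ge0; first lra.
by have [w0|w0] := ger0P w; nra.
Qed.

(** The next three lemmas absorb the cross terms of the remainder into a
    fraction [d] of the dissipation.  The terms of total degree three in [W]
    and [c] are treated by comparing [W] with a multiple of [c]: if [W] is
    large the dissipation wins, otherwise the whole term is of order [c^3] and
    carries two factors [s] or [t]. *)
Lemma absorb_square d s t W c : 0 < d -> 0 <= s -> s <= t -> t <= 1 -> 0 <= W -> 0 <= c ->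
  6 * s ^+ 2 * c * W ^+ 2 <= d * (s * W ^+ 3) + 216 / d ^+ 2 * (t ^+ 2 * c ^+ 3).
Proof.
move=> d0 s0 st t1 W0 c0; have t0 : 0 <= t by lra.
have [h|h] := leP (6 * (s * c)) (d * W).
  apply: ler_wpDr.
    apply: mulr_ge0; first by apply: divr_ge0; [exact: ler0n|exact: sqr_ge0].
    by apply: mulr_ge0; exact: exprn_ge0.
  rewrite (_ : 6 * s ^+ 2 * c * W ^+ 2 = (6 * (s * c)) * (s * W ^+ 2)); last by ring.
  rewrite (_ : d * _ = (d * W) * (s * W ^+ 2)); last by ring.
  by rewrite ler_wpM2r// mulr_ge0// exprn_ge0.
apply: ler_wpDl; first by rewrite !mulr_ge0// ?exprn_ge0// ltW.
pose y := 6 * (s * c) / d.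
have Wy : W <= y by rewrite ler_pdivlMr// mulrC ltW.
have -> : 216 / d ^+ 2 * (t ^+ 2 * c ^+ 3) = 6 * t ^+ 2 * c * (6 * c / d) ^+ 2.
  by field; lra.
have yc : y <= 6 * c / d.
  by rewrite /y ler_pM2r ?invr_gt0//; nra.
rewrite ler_pM//; first by rewrite !mulr_ge0// exprn_ge0.
- exact: exprn_ge0.
- rewrite ler_wpM2r// ler_wpM2l// lerXn2r// nnegrE; lra.
- rewrite lerXn2r ?nnegrE//; first lra.
  lra.
Qed.

Lemma absorb_product d s t p W c : 0 < d -> 0 <= s -> s <= 1 -> 0 <= p ->
  6 * s * t * c * p * W <= d * (s * p * W ^+ 2) + 9 / d * (t ^+ 2 * c ^+ 2 * p).
Proof.
move=> d0 s0 s1 p0.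
have h : 6 * t * c * W <= d * W ^+ 2 + 9 / d * (t ^+ 2 * c ^+ 2).
  rewrite -subr_ge0 (_ : _ - _ = d^-1 * (d * W - 3 * t * c) ^+ 2).
    by rewrite mulr_ge0 ?sqr_ge0// invr_ge0 ltW.
  by field; lra.
have X0 : 0 <= 9 / d * (t ^+ 2 * c ^+ 2).
  apply: mulr_ge0; last by rewrite mulr_ge0 ?sqr_ge0.
  by apply: divr_ge0 => //; exact: ltW.
have sp0 : 0 <= s * p by exact: mulr_ge0.
have := ler_wpM2l sp0 h; set X := 9 / d * _ in X0 *.
have : s * p * X <= p * X by rewrite ler_wpM2r// ler_piMl.
rewrite (_ : 9 / d * (t ^+ 2 * c ^+ 2 * p) = p * X); last by rewrite /X; ring.
by lra.
Qed.

Lemma absorb_linear d s t W c : 0 < d -> d <= 1 -> 0 <= s -> s <= t -> t <= 1 ->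
  0 <= W -> 0 <= c ->
  9 * s * t * c ^+ 2 * W <= d * (s * W ^+ 3) + 81 / d * (t ^+ 2 * c ^+ 3).
Proof.
move=> d0 d1 s0 st t1 W0 c0; have t0 : 0 <= t by lra.
have [h|h] := leP (9 * c) (d * W).
  apply: ler_wpDr.
    by rewrite !mulr_ge0// ?invr_ge0 ?exprn_ge0// ltW.
  have c9 : 9 * c ^+ 2 <= d * W ^+ 2.
    have h2 : (9 * c) ^+ 2 <= (d * W) ^+ 2.
      by rewrite lerXn2r// nnegrE mulr_ge0// ltW.
    have : (d * W) ^+ 2 <= d * W ^+ 2.
      by rewrite exprMn ler_wpM2r ?sqr_ge0// expr2 ger_pMl.
    by have := sqr_ge0 c; rewrite exprMn in h2; lra.
  apply: (@le_trans _ _ (9 * s * 1 * c ^+ 2 * W)).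
    by rewrite !ler_wpM2r// ?sqr_ge0// ler_wpM2l// mulr_ge0.
  rewrite (_ : d * _ = s * W * (d * W ^+ 2)); last by ring.
  rewrite (_ : 9 * s * 1 * c ^+ 2 * W = s * W * (9 * c ^+ 2)); last by ring.
  by rewrite ler_wpM2l// mulr_ge0.
apply: ler_wpDl; first by rewrite !mulr_ge0// ?exprn_ge0// ltW.
have Wy : W <= 9 * c / d by rewrite ler_pdivlMr// mulrC ltW.
rewrite (_ : 81 / d * _ = 9 * t * t * c ^+ 2 * (9 * c / d)); last by field; lra.
rewrite ler_pM// ?mulr_ge0// ?exprn_ge0//.
by rewrite !ler_wpM2r// ?sqr_ge0// ler_wpM2l.
Qed.

Lemma absorption_cst i k m p c : 1 <= i -> 0 <= k -> 0 <= p -> p <= m -> c <= 2 * m ->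
  216 * i ^+ 2 * (k * c) + 9 * i * (k * p) + 81 * i * (k * c) + 5 * (k * m) <=
  608 * i ^+ 2 * (k * m).
Proof.
move=> i1 k0 p0 pm cm.
have kc : k * c <= 2 * (k * m) by rewrite mulrCA ler_wpM2l.
have kp : k * p <= k * m by rewrite ler_wpM2l.
have km : 0 <= k * m by rewrite mulr_ge0// (le_trans p0).
have i0 : 0 <= i by lra.
have i2 : i <= i ^+ 2 by rewrite expr2 ler_peMl.
have ii0 : 0 <= i ^+ 2 by exact: le_trans i2.
move: (k * c) (k * p) (k * m) (i ^+ 2) kc kp km i2 ii0 => C P M I kc kp km i2 ii0.
have A1 := ler_wpM2l ii0 kc; have A2 := ler_wpM2l i0 kp; have A3 := ler_wpM2l i0 kc.
have A4 := ler_wpM2r km i2; have A5 := ler_wpM2r km i1.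
by lra.
Qed.

(** The second order remainder of the cube at [m] for the increment
    [s w + e], where [w = r - p] can be large and [e] is of order [t c].  The
    dissipation bounds it up to terms of order [t^2]. *)
Lemma cubic_remainder d s t m p w e c : 0 < d -> d <= 1 ->
  0 <= s -> s <= t -> t <= 1 -> 4 * d <= 1 - s ->
  0 <= p -> p <= m -> - p <= w -> m - p <= c -> c <= 2 * m -> `|e| <= t * c ->
  (s * w + e) ^+ 2 * (3 * m + s * w + e) <=
  s * w ^+ 2 * (w + 3 * p) + 608 * d^-1 ^+ 2 * (t ^+ 2 * c ^+ 2 * m).
Proof.
move=> d0 d1 s0 st t1 ds p0 pm pw ac cm he.
have a0 : 0 <= m - p by lra.
have c0 : 0 <= c by lra.
have t0 : 0 <= t by lra.
have s1 : s <= 1 by lra.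
pose W := `|w|.
have W0 : 0 <= W by exact: normr_ge0.
have W2 : w ^+ 2 = W ^+ 2 by rewrite /W real_normK// num_real.
have wW : w <= W by exact: ler_norm.
have T0 : s ^+ 2 * W ^+ 2 * (3 * p + s * w) + (1 - s) / 2 * (s * W ^+ 2 * (p + W)) <=
    s * W ^+ 2 * (w + 3 * p).
  by have := cubic_dissipation s0 s1 p0 pw; rewrite -/W W2.
pose E := t * c.
have E0 : 0 <= E by exact: mulr_ge0.
have Ec : E <= c by rewrite ler_piMl.
have ee : e <= E by apply: le_trans he; exact: ler_norm.
have e2 : e ^+ 2 <= E ^+ 2 by rewrite -real_normK ?num_real// lerXn2r// nnegrE.
have X2 : w * e * (3 * m + s * w + e) <= W * E * (3 * m + s * W + c).
  apply: le_trans (ler_norm _) _; rewrite normrM (normrM w e).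
  apply: ler_pM; [exact: mulr_ge0|exact: normr_ge0|exact: ler_wpM2l|].
  apply: le_trans (ler_normD _ _) _; apply: lerD; last exact: le_trans he Ec.
  apply: le_trans (ler_normD _ _) _; apply: lerD.
    by rewrite ler_norml; apply/andP; lra.
  by rewrite normrM (ger0_norm s0).
have Ti := absorb_square d0 s0 st t1 W0 c0.
have Tii := absorb_product t W c d0 s0 s1 p0.
have Tiii := absorb_linear d0 d1 s0 st t1 W0 c0.
have i1 : 1 <= d^-1 by rewrite invf_ge1.
have k0 : 0 <= t ^+ 2 * c ^+ 2 by apply: mulr_ge0; exact: sqr_ge0.
have final := absorption_cst i1 k0 p0 pm cm.
have EE : E = t * c by [].
clearbody W E.
have sW0 : 0 <= s * W by exact: mulr_ge0.
have sWW0 : 0 <= s * W ^+ 2 by rewrite mulr_ge0// sqr_ge0.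
have D0 : 2 * d * (s * W ^+ 2 * (p + W)) <= (1 - s) / 2 * (s * W ^+ 2 * (p + W)).
  by apply: ler_wpM2r; [rewrite mulr_ge0// addr_ge0|lra].
have X1 : s ^+ 2 * W ^+ 2 * (3 * (m - p) + e) <= s ^+ 2 * W ^+ 2 * (4 * c).
  by apply: ler_wpM2l; [apply: mulr_ge0; exact: sqr_ge0|lra].
have X2' : 2 * s * (W * E * (3 * m + s * W + c)) <=
    2 * s * (W * E * (3 * p + 4 * c + s * W)).
  apply: ler_wpM2l; first by lra.
  by apply: ler_wpM2l; [exact: mulr_ge0|lra].
have {}X2 : 2 * s * (w * e * (3 * m + s * w + e)) <=
    2 * s * (W * E * (3 * p + 4 * c + s * W)).
  by apply: le_trans X2'; apply: ler_wpM2l => //; lra.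
have X3 : e ^+ 2 * (3 * m + s * w + e) <= E ^+ 2 * (5 * m + s * W).
  have sw : s * w <= s * W by rewrite ler_wpM2l.
  apply: (@le_trans _ _ (e ^+ 2 * (5 * m + s * W))).
    by apply: ler_wpM2l; [exact: sqr_ge0|lra].
  by apply: ler_wpM2r => //; lra.
have Y1 : s ^+ 2 * W ^+ 2 * E <= s ^+ 2 * W ^+ 2 * c.
  by apply: ler_wpM2l => //; apply: mulr_ge0; exact: sqr_ge0.
have Y2 : E ^+ 2 * (s * W) <= c * E * (s * W).
  by apply: ler_wpM2r => //; rewrite expr2; apply: ler_wpM2r.
have dp : 0 <= d * (s * W ^+ 2 * p) by rewrite mulr_ge0 ?(ltW d0)// mulr_ge0.
have expand : (s * w + e) ^+ 2 * (3 * m + s * w + e) =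
    s ^+ 2 * w ^+ 2 * (3 * p + s * w) + s ^+ 2 * w ^+ 2 * (3 * (m - p) + e) +
    2 * s * (w * e * (3 * m + s * w + e)) + e ^+ 2 * (3 * m + s * w + e) by ring.
rewrite expand W2 EE in X1 X2 X3 Y1 Y2 *.
rewrite -[216 / _]/(216 * _) -exprVn in Ti.
clear - T0 D0 X1 X2 X3 Ti Tii Tiii Y1 Y2 dp final.
move: (d^-1) Ti Tii Tiii final => i Ti Tii Tiii final.
by lra.
Qed.

(** The factor [(1 - b)^-2] reflects the loss of dissipation as the CFL number
    approaches 1. *)
Definition cubic_cst b : R := 1216 * (4 / (1 - b)) ^+ 2.

Lemma cubic_cst_ge0 b : 0 <= cubic_cst b.
Proof. by apply: mulr_ge0; [exact: ler0n|exact: sqr_ge0]. Qed.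

(** The left-hand side less its linearisation at [m] is bounded by the gap
    between [r ^ 3] and its tangent at [p], not at [m]: this is what later
    matches the flux through the interface, where only [p] and [r] occur. *)
Lemma cubic_increment b s t m p q r e f : b < 1 ->
  0 <= s -> s <= t -> t <= b ->
  0 <= p -> p <= m -> 0 <= q -> q <= m -> 0 <= r ->
  `|e| <= t * ((m - p) + (m - q)) ->
  f = m + s * (r - p) + e ->
  f ^+ 3 <= m ^+ 3 + 3 * m ^+ 2 * (s * (r - p) + e) +
    s * (r ^+ 3 - p ^+ 3 - 3 * p ^+ 2 * (r - p)) +
    cubic_cst b * (t ^+ 2 * (m * ((m - p) ^+ 2 + (m - q) ^+ 2))).
Proof.
move=> b1 s0 st tb p0 pm q0 qm r0 he fE.
pose d := (1 - b) / 4.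
have d0 : 0 < d by rewrite /d; lra.
have d1 : d <= 1 by rewrite /d; lra.
have ds : 4 * d <= 1 - s by rewrite /d; lra.
have -> : cubic_cst b = 608 * d^-1 ^+ 2 * 2.
  rewrite /cubic_cst -[d^-1]/(((1 - b) / 4)^-1) invf_div.
  by move: (4 / (1 - b)) => i; ring.
clearbody d.
have t1 : t <= 1 by lra.
have pw : - p <= r - p by lra.
have ac : m - p <= (m - p) + (m - q) by lra.
have cm : (m - p) + (m - q) <= 2 * m by lra.
have := cubic_remainder d0 d1 s0 st t1 ds p0 pm pw ac cm he.
set c := (m - p) + (m - q); set k := 608 * d^-1 ^+ 2.
have k0 : 0 <= k by apply: mulr_ge0; [exact: ler0n|exact: sqr_ge0].
have c2 : c ^+ 2 <= 2 * ((m - p) ^+ 2 + (m - q) ^+ 2).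
  by rewrite -subr_ge0 (_ : _ - _ = (p - q) ^+ 2) ?sqr_ge0// /c; ring.
have tm0 : 0 <= t ^+ 2 * m by rewrite mulr_ge0 ?sqr_ge0//; lra.
have := ler_wpM2l k0 (ler_wpM2l tm0 c2).
move: k c {k0 c2 he ac cm} => k c.
by rewrite fE; lra.
Qed.

End Cubic.

(** * The kinetic entropy inequality, velocity by velocity *)

Section KineticEntropy.
Context {R : realType}.
Implicit Types (g xi z d b s t m p q r e f u h vm sig : R) (V : state R).

(** Here [d] is the jump of topography from the cell to the interface.  The
    slope of the kinetic entropy drops from [m] to [p] by at most [g d]; as [r]
    is nonnegative and the drop is exact where [p] does not vanish, the term
    [s (H0'(m) - H0'(p)) (r - p)] is at most [s g d (r - p)], which raises the
    topography of the flux from [z] to [z + d]. *)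
Lemma kin_entropy_increment g xi z d A b s t m p q r e f : 0 < g -> b < 1 ->
  0 <= s -> s <= t -> t <= b ->
  0 <= p -> p <= m -> 0 <= q -> q <= m -> 0 <= r ->
  `|e| <= t * ((m - p) + (m - q)) ->
  g ^+ 2 * pi ^+ 2 / 2 * (m ^+ 2 - p ^+ 2) <= g * d ->
  (p != 0 -> g ^+ 2 * pi ^+ 2 / 2 * (m ^+ 2 - p ^+ 2) = g * d) ->
  (e != 0 -> xi ^+ 2 / 2 + g ^+ 2 * pi ^+ 2 / 2 * m ^+ 2 = A) ->
  f = m + s * (r - p) + e ->
  kin_entropy g f xi z <= kin_entropy g m xi z
    + s * (kin_entropy g r xi (z + d) - kin_entropy g p xi (z + d))
    + (A + g * z) * e
    + g ^+ 2 * pi ^+ 2 / 6 * (cubic_cst b *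
        (t ^+ 2 * (m * ((m - p) ^+ 2 + (m - q) ^+ 2)))).
Proof.
move=> g0 b1 s0 st tb p0 pm q0 qm r0 he hd hp hA fE.
have := cubic_increment b1 s0 st tb p0 pm q0 qm r0 he fE.
set X := cubic_cst b * _; move: X => X H.
rewrite /kin_entropy /kin_entropy0.
have k0 : 0 <= g ^+ 2 * pi ^+ 2 / 6 by rewrite divr_ge0// -exprMn sqr_ge0.
have {H} := ler_wpM2l k0 H.
have e1 : (xi ^+ 2 / 2 + g ^+ 2 * pi ^+ 2 / 2 * m ^+ 2) * e = A * e.
  by have [->|/hA ->//] := eqVneq e 0; rewrite !mulr0.
have e2 : s * (g ^+ 2 * pi ^+ 2 / 2 * (m ^+ 2 - p ^+ 2) * p) = s * (g * d * p).
  by have [->|/hp ->//] := eqVneq p 0; rewrite !mulr0.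
have e3 : s * r * (g ^+ 2 * pi ^+ 2 / 2 * (m ^+ 2 - p ^+ 2)) <= s * r * (g * d).
  by rewrite ler_wpM2l// mulr_ge0.
move: e1 e2 e3; set k := g ^+ 2 * pi ^+ 2; move: k => k e1 e2 e3 H.
rewrite fE in H *.
lra.
Qed.

(** Half of [g ^ 2 pi ^ 2 m ^ 2] is the slope of the cubic part of the kinetic
    entropy at [m], so this compares the slopes at a Maxwellian and at its
    reconstruction.  Truncation at 0 is nonexpansive, so it does not increase
    the difference, and it does not act where [p] is positive. *)
Lemma maxwellian_sqr_drop g V V' d xi : 0 < g -> 0 <= d ->
  velocity V' = velocity V -> height V' = Num.max 0 (height V - d) ->
  let k := g ^+ 2 * pi ^+ 2 / 2 in
  let m := maxwellian g V xi in let p := maxwellian g V' xi in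
  k * (m ^+ 2 - p ^+ 2) <= g * d /\ (p != 0 -> k * (m ^+ 2 - p ^+ 2) = g * d).
Proof.
move=> g0 d0 uE hE k m p.
have -> : k * (m ^+ 2 - p ^+ 2) =
    (Num.max 0 (2 * g * height V - (xi - velocity V) ^+ 2)
     - Num.max 0 (2 * g * height V' - (xi - velocity V') ^+ 2)) / 2.
  by rewrite -!maxwellian_sqr// /k -/m -/p; field.
rewrite uE; set w2 := (xi - velocity V) ^+ 2.
have w0 : 0 <= w2 := sqr_ge0 _.
have gd : 0 <= g * d by rewrite mulr_ge0// ltW.
split.
  have h1 : g * (height V - d) <= g * height V'.
    by rewrite hE ler_pM2l// le_max lexx orbT.
  have [a1|a1] := leP 0 (2 * g * height V - w2);
  have [a2|a2] := leP 0 (2 * g * height V' - w2); nra.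
move=> p0.
have : 0 < p by rewrite lt0r p0 maxwellian_ge0.
rewrite maxwellian_gt0// uE -/w2 => hw.
have h0 : 0 < g * height V' by lra.
have h' : 0 < height V' by rewrite pmulr_rgt0 in h0.
have hV : height V' = height V - d.
  by move: hE h'; have [a1|a1] := leP 0 (height V - d) => // ->; rewrite ltxx.
rewrite hV in hw *.
rewrite !max_r; nra.
Qed.

(** On the support of a Maxwellian the slope of the kinetic entropy is affine in
    [xi], namely the derivative of the entropy of the state paired with
    [(1, xi)]. *)
Lemma maxwellian_tangent g V xi : 0 < g -> maxwellian g V xi != 0 ->
  xi ^+ 2 / 2 + g ^+ 2 * pi ^+ 2 / 2 * maxwellian g V xi ^+ 2 =
  velocity V * (xi - velocity V) + velocity V ^+ 2 / 2 + g * height V.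
Proof.
move=> g0 m0.
have : 0 < maxwellian g V xi by rewrite lt0r m0 maxwellian_ge0.
rewrite maxwellian_gt0// => hw.
have := maxwellian_sqr V xi g0; rewrite max_r; last by lra.
by lra.
Qed.

(** Convexity at the Maxwellian; outside of its support the slope there exceeds
    the affine function, which is harmless as [f] is nonnegative. *)
Lemma kin_entropy_tangent g V f xi : 0 < g -> 0 <= height V -> 0 <= f ->
  kin_entropy0 g (maxwellian g V xi) xi +
  (velocity V * (xi - velocity V) + velocity V ^+ 2 / 2 + g * height V) *
  (f - maxwellian g V xi) <= kin_entropy0 g f xi.
Proof.
move=> g0 h0 f0; set m := maxwellian g V xi.
have m0 : 0 <= m by exact: maxwellian_ge0.
set k := g ^+ 2 * pi ^+ 2.
have k0 : 0 <= k by rewrite /k -exprMn sqr_ge0.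
have convex : kin_entropy0 g m xi + (xi ^+ 2 / 2 + k / 2 * m ^+ 2) * (f - m) <=
    kin_entropy0 g f xi.
  rewrite -subr_ge0 (_ : _ - _ = k / 6 * ((f - m) ^+ 2 * (f + 2 * m))).
    by rewrite mulr_ge0 ?divr_ge0// mulr_ge0 ?sqr_ge0//; lra.
  by rewrite /kin_entropy0 -/k; field.
apply: le_trans convex; rewrite lerD2l.
have [mE|mN] := eqVneq m 0; last by rewrite -(maxwellian_tangent g0 mN).
rewrite mE subr0; apply: ler_wpM2r => //.
have : ~~ (0 < maxwellian g V xi) by rewrite -/m mE ltxx.
rewrite maxwellian_gt0// -leNgt.
by lra.
Qed.

Lemma maxwellian_support_radius g V xi vm : 0 < g ->
  (forall xi, 0 < maxwellian g V xi -> `|xi| <= vm) ->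
  maxwellian g V xi != 0 ->
  [/\ `|xi| <= vm, `|velocity V| <= vm & `|xi - velocity V| <= vm].
Proof.
move=> g0 supp m0; set u := velocity V.
have mp : 0 < maxwellian g V xi by rewrite lt0r m0 maxwellian_ge0.
(* the support is symmetric about u, so u and xi - u are half the sum and half
   the difference of two velocities bounded by vm *)
have mp' : 0 < maxwellian g V (2 * u - xi).
  move: mp; rewrite !maxwellian_gt0// -/u.
  by rewrite (_ : 2 * u - xi - u = - (xi - u)) ?sqrrN//; ring.
have := supp _ mp; have := supp _ mp'; rewrite !ler_norml.
by move=> /andP[a1 a2] /andP[a3 a4]; split; apply/andP; lra.
Qed.

(** The last term is the kinetic counterpart of the topography source: its mass
    vanishes, and its momentum is the difference of the pressures of the two
    reconstructed states. *)
Definition kin_update sig u m p q r l xi : R :=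
  m - sig * ((Num.max xi 0 * p - Num.max (- xi) 0 * r)
             - (Num.max xi 0 * l - Num.max (- xi) 0 * q)
             + (xi - u) * (q - p)).

End KineticEntropy.

Section KineticScheme.
Context {R : realType}.
Implicit Types (g xi z b p q r l u v sig m dm dp : R) (V Vm Vp : state R).

Lemma bilinear_bound (a b p q m v : R) : `|a| <= v -> `|b| <= v -> `|a + b| <= v ->
  0 <= p -> p <= m -> 0 <= q -> q <= m -> a * p + b * q <= v * m.
Proof.
rewrite !ler_norml => /andP[a1 a2] /andP[b1 b2] /andP[c1 c2] p0 pm q0 qm.
have m0 : 0 <= m by lra.
have [ha|ha] := leP 0 a; have [hb|hb] := leP 0 b; nra.
Qed.

(** The incoming terms are nonnegative.  The outgoing ones combine into
    [u p + (xi - u) q] for [xi >= 0] and [(u - xi) p - u q] for [xi < 0], in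
    which every coefficient and the sum of the two are bounded by [v]. *)
Lemma kin_update_ge0 sig u m p q r l xi v : 0 <= sig -> sig * v <= 1 ->
  0 <= p -> p <= m -> 0 <= q -> q <= m -> 0 <= r -> 0 <= l ->
  (m != 0 -> [/\ `|xi| <= v, `|u| <= v & `|xi - u| <= v]) ->
  0 <= kin_update sig u m p q r l xi.
Proof.
move=> s0 sv p0 pm q0 qm r0 l0 supp; rewrite /kin_update.
have m0 : 0 <= m by lra.
have x1 : 0 <= Num.max xi 0 by rewrite le_max lexx orbT.
have x2 : 0 <= Num.max (- xi) 0 by rewrite le_max lexx orbT.
have in0 : 0 <= sig * (Num.max (- xi) 0 * r + Num.max xi 0 * l).
  by rewrite mulr_ge0// addr_ge0// mulr_ge0.
suff out : sig * (Num.max xi 0 * p + Num.max (- xi) 0 * q + (xi - u) * (q - p)) <= m.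
  by lra.
have [mE|mN] := eqVneq m 0.
  have -> : p = 0 by lra.
  have -> : q = 0 by lra.
  by rewrite mE subrr !mulr0 !addr0 mulr0.
have [hx hu hxu] := supp mN.
suff h : Num.max xi 0 * p + Num.max (- xi) 0 * q + (xi - u) * (q - p) <= v * m.
  apply: le_trans (ler_wpM2l s0 h) _; rewrite mulrA ler_piMl//.
have [x0|x0] := leP 0 xi.
  rewrite max_r ?oppr_le0//.
  rewrite (_ : _ + _ = u * p + (xi - u) * q); last by ring.
  by apply: bilinear_bound => //; rewrite addrC subrK.
rewrite max_l ?oppr_ge0 ?(ltW x0)//.
rewrite (_ : _ + _ = (u - xi) * p + (- u) * q); last by ring.
apply: bilinear_bound => //; [by rewrite distrC|by rewrite normrN|].
by rewrite (_ : _ + _ = - xi) ?normrN//; ring.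
Qed.

(** For either sign of [xi] the update is an upwind step from [m] plus the same
    increment [e = sig u (q - p)].  The third summand on
    the right gathers the terms that are not in flux form; its integral
    vanishes. *)
Lemma kin_entropy_update g z b sig v xi dm dp V Vm Vp r l :
  0 < g -> b < 1 -> 0 <= sig -> sig * v <= b -> 0 <= v -> 0 <= height V ->
  0 <= dm -> 0 <= dp ->
  velocity Vm = velocity V -> velocity Vp = velocity V ->
  height Vm = Num.max 0 (height V - dm) -> height Vp = Num.max 0 (height V - dp) ->
  (forall xi, 0 < maxwellian g V xi -> `|xi| <= v) ->
  0 <= r -> 0 <= l -> (r != 0 -> `|xi| <= v) -> (l != 0 -> `|xi| <= v) ->
  forall u m p q, u = velocity V -> m = maxwellian g V xi ->
  p = maxwellian g Vm xi -> q = maxwellian g Vp xi ->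
  kin_entropy g (kin_update sig u m p q r l xi) xi z <=
  kin_entropy g m xi z
  - sig * ((Num.max xi 0 * kin_entropy g p xi (z + dm)
            - Num.max (- xi) 0 * kin_entropy g r xi (z + dm))
           - (Num.max xi 0 * kin_entropy g l xi (z + dp)
              - Num.max (- xi) 0 * kin_entropy g q xi (z + dp)))
  + sig * (xi * kin_entropy g p xi (z + dm) - xi * kin_entropy g q xi (z + dp)
           + u * ((u * (xi - u) + u ^+ 2 / 2 + g * height V + g * z) * (q - p)))
  + g ^+ 2 * pi ^+ 2 / 6 * (cubic_cst b *
      ((sig * v) ^+ 2 * (m * ((m - p) ^+ 2 + (m - q) ^+ 2)))).
Proof.
move=> g0 b1 s0 sv v0 h0 dm0 dp0 uM uP hM hP supp r0 l0 rs ls u m p q uE mE pE qE.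
have p0 : 0 <= p by rewrite pE maxwellian_ge0.
have q0 : 0 <= q by rewrite qE maxwellian_ge0.
have hle V' d : 0 <= d -> height V' = Num.max 0 (height V - d) -> height V' <= height V.
  by move=> d0 ->; rewrite ge_max h0; lra.
have pm : p <= m by rewrite pE mE; apply: maxwellian_le => //; exact: hle hM.
have qm : q <= m by rewrite qE mE; apply: maxwellian_le => //; exact: hle hP.
have suppm : m != 0 -> [/\ `|xi| <= v, `|u| <= v & `|xi - u| <= v].
  by rewrite uE mE; exact: maxwellian_support_radius.
have [hxi|hxi] := leP `|xi| v; last first.
  (* no particle of the stencil has a velocity beyond v *)
  have m0 : m = 0 by apply: contraTeq hxi => /suppm[+ _ _]; rewrite -leNgt.
  have rE : r = 0 by apply: contraTeq hxi => /rs; rewrite -leNgt.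
  have lE : l = 0 by apply: contraTeq hxi => /ls; rewrite -leNgt.
  have p00 : p = 0 by lra.
  have q00 : q = 0 by lra.
  rewrite /kin_update m0 rE lE p00 q00 /kin_entropy /kin_entropy0.
  by rewrite le_eqVlt; apply/orP; left; apply/eqP; ring.
have t0 : 0 <= sig * v by exact: mulr_ge0.
have [kp1 kp2] := maxwellian_sqr_drop xi g0 dm0 uM hM; rewrite -mE -pE in kp1 kp2.
have [kq1 kq2] := maxwellian_sqr_drop xi g0 dp0 uP hP; rewrite -mE -qE in kq1 kq2.
set e := sig * (u * (q - p)).
have he : `|e| <= (sig * v) * ((m - p) + (m - q)).
  have [m0|mN] := eqVneq m 0.
    have p00 : p = 0 by lra.
    have q00 : q = 0 by lra.
    by rewrite /e p00 q00 m0 !subrr !mulr0 normr0 addr0 mulr0.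
  have [_ hu _] := suppm mN.
  rewrite /e -mulrA normrM (ger0_norm s0) ler_wpM2l// normrM ler_pM//.
  by rewrite ler_norml; apply/andP; lra.
have hA : e != 0 -> xi ^+ 2 / 2 + g ^+ 2 * pi ^+ 2 / 2 * m ^+ 2 =
    u * (xi - u) + u ^+ 2 / 2 + g * height V.
  move=> eN; rewrite uE mE; apply: maxwellian_tangent => //; rewrite -mE.
  apply: contraNneq eN => m0.
  have p00 : p = 0 by lra.
  have q00 : q = 0 by lra.
  by rewrite /e p00 q00 subrr !mulr0.
have [x0|x0] := leP 0 xi.
  have xp : Num.max xi 0 = xi by exact: max_l.
  have xn : Num.max (- xi) 0 = 0 by rewrite max_r// oppr_le0.
  rewrite xn.
  have sx0 : 0 <= sig * xi by exact: mulr_ge0.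
  have sxt : sig * xi <= sig * v by rewrite ler_wpM2l//; rewrite ger0_norm// in hxi.
  have he' : `|e| <= sig * v * ((m - q) + (m - p)) by rewrite addrC.
  have fE : kin_update sig u m p q r l xi = m + sig * xi * (l - q) + e.
    by rewrite /kin_update xp xn /e; ring.
  have := kin_entropy_increment z g0 b1 sx0 sxt sv q0 qm p0 pm l0 he' kq1 kq2 hA fE.
  move/le_trans; apply; rewrite [(m - q) ^+ 2 + _]addrC.
  by rewrite -subr_ge0 le_eqVlt; apply/orP; left; apply/eqP; rewrite /e; ring.
have xp : Num.max xi 0 = 0 by exact/max_r/ltW.
have xn : Num.max (- xi) 0 = - xi by rewrite max_l// oppr_ge0 ltW.
rewrite xn.
have sx0 : 0 <= sig * - xi by rewrite mulr_ge0// oppr_ge0 ltW.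
have sxt : sig * - xi <= sig * v by rewrite ler_wpM2l//; rewrite ltr0_norm// in hxi.
have fE : kin_update sig u m p q r l xi = m + sig * - xi * (r - p) + e.
  by rewrite /kin_update xp xn /e; ring.
have := kin_entropy_increment z g0 b1 sx0 sxt sv p0 pm q0 qm r0 he kp1 kp2 hA fE.
move/le_trans; apply.
by rewrite -subr_ge0 le_eqVlt; apply/orP; left; apply/eqP; rewrite /e; ring.
Qed.

End KineticScheme.

(** * Integration in velocity: the inequality in one cell *)

Section Assembly.
Context {R : realType}.
Implicit Types (g z zeta b v sig dm dp : R) (V Vm Vp Wl Wr : state R) (f : R -> R).

Lemma csupp_kin_entropy g zeta f : csupp f ->
  csupp (fun xi => kin_entropy g (f xi) xi zeta).
Proof. by move=> sf; rewrite /kin_entropy /kin_entropy0; solve_csupp. Qed.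

(** The pointwise tangent inequality at the Maxwellian of [V] integrates to the
    claim: its right-hand side is affine in [xi] times [f] less the Maxwellian,
    two densities with the same moments. *)
Lemma entropy_minimization g z V f : 0 < g -> 0 <= height V -> csupp f ->
  (forall xi, 0 <= f xi) ->
  intR f = height V -> intR (fun xi => xi * f xi) = discharge V ->
  entropy g V + g * z * height V <= intR (fun xi => kin_entropy g (f xi) xi z).
Proof.
move=> g0 h0 sf f0 If Ixf; set u := velocity V; set h := height V.
pose M := maxwellian g V; have sM : csupp M := csupp_maxwellian g V.
pose k := - u ^+ 2 / 2 + g * h + g * z.
have IM : intR M = h by exact: intR_maxwellian.
have IxM : intR (fun xi => xi * M xi) = discharge V.
  rewrite (@intR_maxwellian_poly _ g V (fun xi => xi) u 1 0 0)//.
    by rewrite mul0r addr0 mulrC.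
  by move=> xi; rewrite -/u; ring.
have sH : csupp (fun xi => kin_entropy g (M xi) xi z) by exact: csupp_kin_entropy.
have sxf : csupp (fun xi => xi * f xi) by solve_csupp.
have sxM : csupp (fun xi => xi * M xi) by solve_csupp.
pose c := fun xi => (u * (xi * f xi) + k * f xi) - (u * (xi * M xi) + k * M xi).
have sc : csupp c by rewrite /c; solve_csupp.
have -> : entropy g V + g * z * h = intR (fun xi => kin_entropy g (M xi) xi z + c xi).
  rewrite intRD// intR_kin_entropy// intRB; [|solve_csupp|solve_csupp].
  rewrite !intRD; [|solve_csupp..].
  rewrite (intRZ u sxf) (intRZ k sf) (intRZ u sxM) (intRZ k sM).
  by rewrite If IM Ixf IxM -/h; ring.
apply: intR_le.
- exact: csuppD.
- exact: csupp_kin_entropy.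
- move=> xi; have := kin_entropy_tangent xi g0 h0 (f0 xi).
  by rewrite /kin_entropy /c -/(M xi) -/u -/h /k; lra.
Qed.

(** One factor [m - p] is traded for [(m + p) (m - p)], which is at most a
    multiple of the difference of heights; the other one integrates to this
    difference. *)
Lemma intR_reconstruction_error g V Vm : 0 < g -> 0 <= height Vm ->
  height Vm <= height V -> velocity Vm = velocity V ->
  g ^+ 2 * pi ^+ 2 / 6 *
    intR (fun xi => maxwellian g V xi * (maxwellian g V xi - maxwellian g Vm xi) ^+ 2)
  <= g * (height V - height Vm) ^+ 2 / 3.
Proof.
move=> g0 hm0 hmh uE; pose d := height V - height Vm.
have d0 : 0 <= d by rewrite /d; lra.
have hd : height Vm = Num.max 0 (height V - d) by rewrite max_r /d; lra.
pose m := maxwellian g V; pose p := maxwellian g Vm.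
have sm : csupp m := csupp_maxwellian g V.
have sp : csupp p := csupp_maxwellian g Vm.
have -> : g * (height V - height Vm) ^+ 2 / 3 = intR (fun xi => g * d / 3 * (m xi - p xi)).
  rewrite intRZ; last solve_csupp.
  by rewrite intRB// !intR_maxwellian// /d; [field|lra].
rewrite -intRZ; last solve_csupp.
apply: intR_le; [solve_csupp|solve_csupp|] => xi.
have [kd _] := maxwellian_sqr_drop xi g0 d0 uE hd.
have pm : p xi <= m xi by exact: maxwellian_le.
have p0 : 0 <= p xi by exact: maxwellian_ge0.
move: kd; rewrite -/(m xi) -/(p xi); move: (m xi) (p xi) pm p0 => a c ca c0.
have : 0 <= g ^+ 2 * pi ^+ 2 by rewrite -exprMn sqr_ge0.
set k := g ^+ 2 * pi ^+ 2; move: k => k k0 kd.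
have ac0 : 0 <= a - c by lra.
have h1 := ler_wpM2r ac0 kd.
have h2 : 0 <= k / 2 * (c * (a - c) ^+ 2).
  by rewrite mulr_ge0 ?divr_ge0// mulr_ge0 ?sqr_ge0.
have e : k / 2 * (a ^+ 2 - c ^+ 2) * (a - c) =
  k / 2 * (a * (a - c) ^+ 2) + k / 2 * (c * (a - c) ^+ 2) by ring.
by lra.
Qed.

(** After integration only [h' (h' + d - h)] remains for each reconstructed
    height [h'], and this vanishes since [h'] is either 0 or [h - d]. *)
Lemma intR_well_balanced g z dm dp V Vm Vp : 0 < g -> 0 <= height V ->
  velocity Vm = velocity V -> velocity Vp = velocity V ->
  height Vm = Num.max 0 (height V - dm) -> height Vp = Num.max 0 (height V - dp) ->
  let u := velocity V in
  intR (fun xi => xi * kin_entropy g (maxwellian g Vm xi) xi (z + dm)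
           - xi * kin_entropy g (maxwellian g Vp xi) xi (z + dp)
           + u * ((u * (xi - u) + u ^+ 2 / 2 + g * height V + g * z) *
                  (maxwellian g Vp xi - maxwellian g Vm xi))) = 0.
Proof.
move=> g0 h0 uM uP hM hP u.
have hm0 : 0 <= height Vm by rewrite hM le_max lexx.
have hp0 : 0 <= height Vp by rewrite hP le_max lexx.
have drop V' d : height V' = Num.max 0 (height V - d) ->
    height V' * (height V' + d - height V) = 0.
  by move=> ->; have [h|h] := leP 0 (height V - d); rewrite ?mul0r//; ring.
have lin V' : velocity V' = u -> 0 <= height V' ->
    intR (fun xi => (u * (xi - u) + u ^+ 2 / 2 + g * height V + g * z) *
                   maxwellian g V' xi) =
    (u ^+ 2 / 2 + g * height V + g * z) * height V'.
  move=> uV' hV'.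
  rewrite (@intR_maxwellian_poly _ g V' _ (u ^+ 2 / 2 + g * height V + g * z) u 0 0)//.
    by ring.
  by move=> xi; rewrite uV'; ring.
pose m := maxwellian g Vm; pose p := maxwellian g Vp.
have sm : csupp m := csupp_maxwellian g Vm.
have sp : csupp p := csupp_maxwellian g Vp.
have sHm : csupp (fun xi => kin_entropy g (m xi) xi (z + dm)) by exact: csupp_kin_entropy.
have sHp : csupp (fun xi => kin_entropy g (p xi) xi (z + dp)) by exact: csupp_kin_entropy.
rewrite intRD; [|solve_csupp..].
rewrite intRB; [|solve_csupp..].
rewrite intRZ; last solve_csupp.
rewrite !intR_kin_entropy_flux//.
under [X in _ + u * X]intR_eq do rewrite mulrBr.
rewrite intRB; [|solve_csupp..].
rewrite !lin// uM uP -/u.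
have := drop _ _ hM; have := drop _ _ hP.
set a := height Vm; set c := height Vp; set h := height V => ec ea.
transitivity (u * g * (a * (a + dm - h)) - u * g * (c * (c + dp - h))); first by ring.
by rewrite ec ea; ring.
Qed.

End Assembly.

Section CellEntropy.
Context {R : realType}.
Implicit Types (g z zeta b v sig dm dp : R) (V Vm Vp Wl Wr : state R) (f : R -> R).
Local Notation mu := (@lebesgue_measure R).

Definition upwind (a c : R -> R) (xi : R) : R :=
  Num.max xi 0 * a xi - Num.max (- xi) 0 * c xi.

Definition kin_entropy_flux g zeta Vl Vr : R :=
  intR (upwind (fun xi => kin_entropy g (maxwellian g Vl xi) xi zeta)
              (fun xi => kin_entropy g (maxwellian g Vr xi) xi zeta)).

Lemma csupp_upwind (a c : R -> R) : csupp a -> csupp c -> csupp (upwind a c).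
Proof. by move=> sa sc; rewrite /upwind; solve_csupp. Qed.

Lemma mass_fluxE g Vl Vr :
  mass_flux g Vl Vr = intR (upwind (maxwellian g Vl) (maxwellian g Vr)).
Proof. by rewrite /mass_flux intR_halves//; exact: csupp_maxwellian. Qed.

Lemma momentum_fluxE g Vl Vr : momentum_flux g Vl Vr =
  intR (fun xi => xi * upwind (maxwellian g Vl) (maxwellian g Vr) xi).
Proof.
rewrite /momentum_flux intR_halves; [|solve_csupp..].
by apply: intR_eq => xi; rewrite /upwind; ring.
Qed.

Lemma kin_entropy_fluxE g zeta Vl Vr :
  \int[mu]_(xi in `]-oo, 0[) (xi * kin_entropy g (maxwellian g Vr xi) xi zeta) +
  \int[mu]_(xi in `]0, +oo[) (xi * kin_entropy g (maxwellian g Vl xi) xi zeta) =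
  kin_entropy_flux g zeta Vl Vr.
Proof.
by rewrite addrC intR_halves//; apply: csupp_kin_entropy; exact: csupp_maxwellian.
Qed.

(** The topography contributes [g zeta] times the mass to the kinetic entropy,
    hence [g zeta] times the mass flux. *)
Lemma kin_entropy_flux_split g zeta Vl Vr :
  kin_entropy_flux g zeta Vl Vr =
  entropy_flux g Vl Vr + g * zeta * mass_flux g Vl Vr.
Proof.
pose k := g * zeta.
have sl : csupp (maxwellian g Vl) := csupp_maxwellian g Vl.
have sr : csupp (maxwellian g Vr) := csupp_maxwellian g Vr.
have s0 V : csupp (fun xi => kin_entropy0 g (maxwellian g V xi) xi).
  by rewrite /kin_entropy0; have := csupp_maxwellian g V => ?; solve_csupp.
rewrite mass_fluxE /entropy_flux intR_halves// -(intRZ _ (csupp_upwind sl sr)) -intRD.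
- by apply: intR_eq => xi; rewrite /upwind /kin_entropy; ring.
- by apply: csupp_upwind.
- by apply: csuppMl; [exact: continuous_cstr|exact: csupp_upwind].
Qed.

(** The states [Vm], [Vp] are the reconstructions of [V] at its right and left
    interfaces, [Wr] and [Wl] those of the neighbours at the same interfaces,
    and [dm], [dp] the jumps of topography. *)
Lemma cell_entropy g z b v sig dm dp V Vm Vp Wl Wr V1 :
  0 < g -> b < 1 -> 0 <= sig -> sig * v <= b -> 0 <= v ->
  0 <= height V -> 0 <= dm -> 0 <= dp ->
  velocity Vm = velocity V -> velocity Vp = velocity V ->
  height Vm = Num.max 0 (height V - dm) -> height Vp = Num.max 0 (height V - dp) ->
  (forall xi, 0 < maxwellian g V xi -> `|xi| <= v) ->
  (forall xi, 0 < maxwellian g Wl xi -> `|xi| <= v) ->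
  (forall xi, 0 < maxwellian g Wr xi -> `|xi| <= v) ->
  height V1 = height V - sig * (mass_flux g Vm Wr - mass_flux g Wl Vp) ->
  discharge V1 = discharge V - sig *
    (momentum_flux g Vm Wr + (g * (height V ^+ 2 / 2) - g * (height Vm ^+ 2 / 2)) -
     (momentum_flux g Wl Vp + (g * (height V ^+ 2 / 2) - g * (height Vp ^+ 2 / 2)))) ->
  entropy g V1 + g * z * height V1 <=
  entropy g V + g * z * height V - sig * (kin_entropy_flux g (z + dm) Vm Wr -
           kin_entropy_flux g (z + dp) Wl Vp) +
  cubic_cst b / 3 * (sig * v) ^+ 2 *
    (g * (height V - height Vm) ^+ 2 + g * (height V - height Vp) ^+ 2).
Proof.
move=> g0 b1 s0 sv v0 h0 dm0 dp0 uM uP hM hP supp suppl suppr hV1 dV1.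
pose u := velocity V.
pose m := maxwellian g V; pose p := maxwellian g Vm; pose q := maxwellian g Vp.
pose r := maxwellian g Wr; pose l := maxwellian g Wl.
have sm : csupp m := csupp_maxwellian g V.
have sp : csupp p := csupp_maxwellian g Vm.
have sq : csupp q := csupp_maxwellian g Vp.
have sr : csupp r := csupp_maxwellian g Wr.
have sl : csupp l := csupp_maxwellian g Wl.
have hm0 : 0 <= height Vm by rewrite hM le_max lexx.
have hp0 : 0 <= height Vp by rewrite hP le_max lexx.
have hmh : height Vm <= height V by rewrite hM ge_max h0; lra.
have hph : height Vp <= height V by rewrite hP ge_max h0; lra.
have pm xi : p xi <= m xi by apply: maxwellian_le.
have qm xi : q xi <= m xi by apply: maxwellian_le.
have M0 W xi : 0 <= maxwellian g W xi by exact: maxwellian_ge0.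
pose f xi := kin_update sig u (m xi) (p xi) (q xi) (r xi) (l xi) xi.
have s1 := csupp_upwind sp sr; have s2 := csupp_upwind sl sq.
pose F xi := upwind p r xi - upwind l q xi + (xi - u) * (q xi - p xi).
have sF : csupp F by rewrite /F; solve_csupp.
have fE xi : f xi = m xi - sig * F xi by [].
have sf : csupp f by rewrite (funext fE); solve_csupp.
have f0 xi : 0 <= f xi.
  apply: (@kin_update_ge0 _ _ _ _ _ _ _ _ _ v) => //; try exact: M0; first lra.
  exact: maxwellian_support_radius.
have mom1 V' : velocity V' = u -> 0 <= height V' ->
    intR (fun xi => (xi - u) * maxwellian g V' xi) = 0.
  move=> uV' hV'; rewrite (@intR_maxwellian_poly _ g V' _ 0 1 0 0)//.
    by rewrite !mul0r addr0.
  by move=> xi; rewrite uV'; ring.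
have mom2 V' : velocity V' = u -> 0 <= height V' ->
    intR (fun xi => xi * (xi - u) * maxwellian g V' xi) = g * (height V' ^+ 2 / 2).
  move=> uV' hV'; rewrite (@intR_maxwellian_poly _ g V' _ 0 u 1 0)//.
    by ring.
  by move=> xi; rewrite uV'; ring.
have If : intR f = height V1.
  rewrite (intR_eq fE) intRB; [|solve_csupp..].
  rewrite (intRZ sig sF) hV1 !mass_fluxE intR_maxwellian// -/p -/r -/l -/q.
  have sq1 : csupp (fun xi => (xi - u) * q xi) by solve_csupp.
  have sp1 : csupp (fun xi => (xi - u) * p xi) by solve_csupp.
  have -> : intR F = intR (fun xi => (upwind p r xi - upwind l q xi) +
      ((xi - u) * q xi - (xi - u) * p xi)).
    by apply: intR_eq => xi; rewrite /F mulrBr.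
  rewrite (intRD (csuppB s1 s2) (csuppB sq1 sp1)) (intRB s1 s2) (intRB sq1 sp1).
  by rewrite !mom1//; ring.
have Ixf : intR (fun xi => xi * f xi) = discharge V1.
  have sxF : csupp (fun xi => xi * F xi) by solve_csupp.
  transitivity (intR (fun xi => xi * m xi - sig * (xi * F xi))).
    by apply: intR_eq => xi; rewrite fE; ring.
  rewrite intRB; [|solve_csupp..].
  rewrite (intRZ sig sxF) dV1 !momentum_fluxE -/p -/r -/l -/q.
  have -> : intR (fun xi => xi * m xi) = discharge V.
    rewrite (@intR_maxwellian_poly _ g V (fun xi => xi) u 1 0 0)//.
      by rewrite mul0r addr0 mulrC.
    by move=> xi; rewrite -/u; ring.
  have -> : intR (fun xi => xi * F xi) = intR (fun xi =>
      (xi * upwind p r xi - xi * upwind l q xi) +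
      (xi * (xi - u) * q xi - xi * (xi - u) * p xi)).
    by apply: intR_eq => xi; rewrite /F; ring.
  have sq2 : csupp (fun xi => xi * (xi - u) * q xi) by solve_csupp.
  have sp2 : csupp (fun xi => xi * (xi - u) * p xi) by solve_csupp.
  have s1x : csupp (fun xi => xi * upwind p r xi) by solve_csupp.
  have s2x : csupp (fun xi => xi * upwind l q xi) by solve_csupp.
  rewrite (intRD (csuppB s1x s2x) (csuppB sq2 sp2)) (intRB s1x s2x) (intRB sq2 sp2).
  by rewrite !mom2//; ring.
have hV10 : 0 <= height V1 by rewrite -If; exact: intR_ge0.
apply: le_trans (entropy_minimization z g0 hV10 sf f0 If Ixf) _.
have sHm := csupp_kin_entropy g z sm.
have sG1 : csupp (upwind (fun xi => kin_entropy g (p xi) xi (z + dm))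
                         (fun xi => kin_entropy g (r xi) xi (z + dm))).
  by apply: csupp_upwind; exact: csupp_kin_entropy.
have sG2 : csupp (upwind (fun xi => kin_entropy g (l xi) xi (z + dp))
                         (fun xi => kin_entropy g (q xi) xi (z + dp))).
  by apply: csupp_upwind; exact: csupp_kin_entropy.
pose D xi := xi * kin_entropy g (p xi) xi (z + dm)
  - xi * kin_entropy g (q xi) xi (z + dp)
  + u * ((u * (xi - u) + u ^+ 2 / 2 + g * height V + g * z) * (q xi - p xi)).
have sD : csupp D.
  have := csupp_kin_entropy g (z + dm) sp => ?.
  have := csupp_kin_entropy g (z + dp) sq => ?.
  by rewrite /D; solve_csupp.
have ID : intR D = 0 by exact: intR_well_balanced.
pose E1 xi := m xi * (m xi - p xi) ^+ 2; pose E2 xi := m xi * (m xi - q xi) ^+ 2.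
have sE1 : csupp E1 by rewrite /E1; solve_csupp.
have sE2 : csupp E2 by rewrite /E2; solve_csupp.
pose K := g ^+ 2 * pi ^+ 2 / 6 * (cubic_cst b * (sig * v) ^+ 2).
pose G12 xi := upwind (fun xi => kin_entropy g (p xi) xi (z + dm))
                         (fun xi => kin_entropy g (r xi) xi (z + dm)) xi -
    upwind (fun xi => kin_entropy g (l xi) xi (z + dp))
                         (fun xi => kin_entropy g (q xi) xi (z + dp)) xi.
have sG12 : csupp G12 by rewrite /G12; solve_csupp.
pose B xi := kin_entropy g (m xi) xi z - sig * G12 xi + (sig * D xi + K * (E1 xi + E2 xi)).
have sE12 : csupp (fun xi => E1 xi + E2 xi) by solve_csupp.
have sB : csupp B by rewrite /B; solve_csupp.
apply: (@le_trans _ _ (intR B)).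
  apply: intR_le => //; first exact: csupp_kin_entropy.
  move=> xi.
  have rs : r xi != 0 -> `|xi| <= v by move=> rN; apply: suppr; rewrite lt0r rN M0.
  have ls : l xi != 0 -> `|xi| <= v by move=> lN; apply: suppl; rewrite lt0r lN M0.
  have := kin_entropy_update z g0 b1 s0 sv v0 h0 dm0 dp0 uM uP hM hP supp
    (M0 Wr xi) (M0 Wl xi) rs ls erefl erefl erefl erefl.
  rewrite -/u -/(m xi) -/(p xi) -/(q xi) -/(r xi) -/(l xi) -/(f xi).
  move/le_trans; apply; rewrite /B /K /G12 /upwind /D /E1 /E2.
  by rewrite -subr_ge0 le_eqVlt; apply/orP; left; apply/eqP; ring.
have -> : intR B = entropy g V + g * z * height V -
    sig * (kin_entropy_flux g (z + dm) Vm Wr -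
           kin_entropy_flux g (z + dp) Wl Vp) + K * (intR E1 + intR E2).
  have sKE : csupp (fun xi => K * (E1 xi + E2 xi)) by solve_csupp.
  have ssD : csupp (fun xi => sig * D xi) by solve_csupp.
  have ssG : csupp (fun xi => sig * G12 xi) by solve_csupp.
  rewrite /B (intRD (csuppB sHm ssG) (csuppD ssD sKE)) (intRB sHm ssG) (intRD ssD sKE).
  rewrite (intRZ _ sD) ID (intRZ _ sE12) (intRD sE1 sE2) (intRZ _ sG12) (intRB sG1 sG2).
  by rewrite intR_kin_entropy// mulr0 add0r.
rewrite lerD2l.
have e1 := intR_reconstruction_error g0 hm0 hmh uM.
have e2 := intR_reconstruction_error g0 hp0 hph uP.
have c0 : 0 <= cubic_cst b * (sig * v) ^+ 2.
  by rewrite mulr_ge0 ?cubic_cst_ge0 ?sqr_ge0.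
have := ler_wpM2l c0 (lerD e1 e2).
rewrite -/m -/p -/q -/(E1) -/(E2) /K.
set k := g ^+ 2 * pi ^+ 2 / 6; move: k => k.
by lra.
Qed.

End CellEntropy.

(** * Piecewise constant functions on a grid *)

Section PiecewiseConstant.
Context {R : realType}.
Implicit Types (x : int -> R) (e : int -> R) (i j : int) (y a b d K : R).
Local Notation mu := (@lebesgue_measure R).

Lemma grid_homo x : (forall i, x (i - 1) < x i) -> forall i j, i <= j -> x i <= x j.
Proof.
move=> xi i j ij; have [n ->] : exists n : nat, j = i + n%:Z.
  by exists `|j - i|%N; rewrite gez0_abs ?subr_ge0//; ring.
elim: n {ij} => [|n IH]; first by rewrite addr0.
apply: le_trans IH _; have := xi (i + n.+1%:Z).
rewrite (_ : i + n.+1%:Z - 1 = i + n%:Z); first by move/ltW.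
by rewrite intS; ring.
Qed.

Definition cell x i : set R := `]x (i - 1), x i[.

Lemma cell_inj x i j y : (forall i, x (i - 1) < x i) ->
  cell x i y -> cell x j y -> i = j.
Proof.
move=> xi; wlog ij : i j / i < j.
  move=> H ci cj; have [ij|ji|//] := ltgtP i j; first exact: H.
  by apply/esym; exact: H.
rewrite /cell/= !in_itv/= => /andP[_ y1] /andP[y2 _]; exfalso.
have : x i <= x (j - 1) by apply: grid_homo => //; lia.
by rewrite leNgt (lt_trans y2 y1).
Qed.

Definition on_cell x e i y : R := e i * \1_(cell x i) y.

Lemma on_cell_ge0 x e i y : (forall i, 0 <= e i) -> 0 <= on_cell x e i y.
Proof. by move=> e0; rewrite mulr_ge0. Qed.

(** Integers are enumerated through their two constructors, which pairs the
    cells [n] and [- n - 1]. *)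
Lemma piecewise_constant_series x e y : (forall i, x (i - 1) < x i) ->
  (forall i, 0 <= e i) ->
  (piecewise_constant x e y)%:E =
  (\sum_(n <oo) (on_cell x e (Posz n) y + on_cell x e (Negz n) y)%:E)%E.
Proof.
move=> xi e0; rewrite /piecewise_constant.
have oc0 i : ~ cell x i y -> on_cell x e i y = 0.
  by move=> ny; rewrite /on_cell indicE memNset// mulr0.
have [[i yi]|none] := pselect (exists i, cell x i y); last first.
  have no i : on_cell x e i y = 0 by apply: oc0 => yi; apply: none; exists i.
  rewrite fsbig1; last by move=> i _; exact: no.
  by rewrite eseries0// => n _ _; rewrite !no addr0.
have other j : j != i -> on_cell x e j y = 0.
  by move=> ji; apply: oc0 => yj; move: ji; rewrite (cell_inj xi yj yi) eqxx.
rewrite -(fsbig_widen [set i])//; last first.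
  by move=> j [_ ji]; apply: other; apply/eqP.
rewrite fsbig_set1 -/(cell x i) -/(on_cell x e i y).
pose n := match i with Posz n => n | Negz n => n end.
have g0 k : true -> (0 <= (on_cell x e (Posz k) y + on_cell x e (Negz k) y)%:E)%E.
  by move=> _; rewrite lee_fin addr_ge0// on_cell_ge0.
rewrite (@nneseriesD1 _ _ n xpredT g0)// eseries0 ?adde0; last first.
  move=> k _ /= kn; rewrite !other ?addr0//.
    by apply: contraNneq kn => ki; rewrite /n -ki.
  by apply: contraNneq kn => ki; rewrite /n -ki.
congr EFin; rewrite /n; case: (i) other => k other.
  by rewrite [X in _ + X]other ?addr0.
by rewrite [X in X + _]other ?add0r.
Qed.

Lemma telescope_int (t : int -> R) N :
  \sum_(0 <= n < N) ((t (Posz n) - t (Posz n - 1)) + (t (Negz n) - t (Negz n - 1)))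
  = t (N%:Z - 1) - t (- N%:Z - 1).
Proof.
elim: N => [|N IH]; first by rewrite big_geq// subrr.
rewrite big_nat_recr//= IH.
rewrite (_ : - N%:Z - 1 = Negz N); last by rewrite NegzE intS; ring.
rewrite (_ : N.+1%:Z - 1 = N); last by rewrite intS; ring.
rewrite (_ : - N.+1%:Z - 1 = Negz N - 1); last by rewrite NegzE.
by ring.
Qed.

Lemma measurable_on_cell x e i (D : set R) :
  measurable_fun (D : set (measurableTypeR R)) (on_cell x e i).
Proof.
apply: measurable_realfun.measurable_funM; first exact: measurable_cst.
by apply: measurable_realfun.measurable_indic; exact: measurable_itv.
Qed.

Lemma integral_on_cell x e i (D : set R) :
  measurable (D : set (measurableTypeR R)) -> x (i - 1) < x i -> 0 <= e i ->
  (\int[mu]_(y in D) (on_cell x e i y)%:E =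
   (e i)%:E * mu (cell x i `&` D))%E.
Proof.
move=> mD xi e0; have mc : measurable (cell x i) by exact: measurable_itv.
rewrite /on_cell (@integralZl_indic _ _ _ _ _ mD (fun=> cell x i))//.
  by rewrite integral_indic.
by move=> en; move: e0; rewrite leNgt en.
Qed.

(** Clamping the grid points to the interval enlarged by twice the mesh size
    makes the right-hand sides telescope, while every cell that meets [a, b]
    keeps its neighbouring grid points.  This also covers grids with
    accumulation points, for which infinitely many cells meet [a, b]. *)
Lemma L1_norm_piecewise_constant_le x e a b d K :
  (forall i, x (i - 1) < x i) -> (forall i, dx x i <= d) ->
  (forall i, 0 <= e i) -> 0 <= K -> a <= b ->
  (forall i, e i * dx x i <= K * (x (i + 1) - x (i - 2))) ->
  (L1_norm a b (piecewise_constant x e) <= (3 * K * (b - a + 4 * d))%:E)%E.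
Proof.
move=> xi dxd e0 K0 ab eK; have xh := grid_homo xi.
have d0 : 0 <= d by apply: le_trans (dxd 0); rewrite /dx subr_ge0 ltW.
pose A := a - 2 * d; pose B := b + 2 * d.
have [c [c_bounds c_homo c_id]] : exists c : R -> R, [/\ forall y, A <= c y <= B,
    forall y y', y <= y' -> c y <= c y' & forall y, A <= y -> y <= B -> c y = y].
  exists (fun y => Num.min (Num.max y A) B); split.
  - move=> y; rewrite ge_min lexx orbT andbT le_min le_max lexx orbT/=.
    by rewrite /A /B; lra.
  - by move=> y y' yy; rewrite le_min !ge_min ge_max !le_max yy !lexx !orbT.
  - by move=> y h1 h2; rewrite max_l// min_l.
have mab : measurable (`[a, b] : set (measurableTypeR R)) by exact: measurable_itv.
have bound i : (\int[mu]_(y in `[a, b]) (on_cell x e i y)%:E <=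
    (K * (c (x (i + 1)) - c (x (i - 2))))%:E)%E.
  rewrite integral_on_cell//.
  have [[y [yi yab]]|none] := pselect (exists y, (cell x i `&` `[a, b]) y); last first.
    rewrite (_ : _ `&` _ = set0) ?measure0 ?mule0.
      by rewrite lee_fin mulr_ge0// subr_ge0 c_homo// xh// lerD2l.
    by apply/seteqP; split => // y yi; apply: none; exists y.
  move: yi yab; rewrite /cell/= !in_itv/= => /andP[y1 y2] /andP[ay yb].
  have e1 : x (i + 1) - x i <= d by have := dxd (i + 1); rewrite /dx addrK.
  have e2 : x i - x (i - 1) <= d by exact: dxd.
  have e3 : x (i - 1) - x (i - 2) <= d.
    by have := dxd (i - 1); rewrite /dx (_ : i - 1 - 1 = i - 2)//; ring.
  have l1 : x (i - 2) <= x (i - 1) by apply: xh; rewrite lerD2l.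
  have l2 : x i <= x (i + 1) by apply: xh; rewrite lerDl.
  rewrite !c_id /A /B; [|lra..].
  apply: (@le_trans _ _ ((e i)%:E * mu (cell x i))%E).
    apply: lee_wpmul2l; first by rewrite lee_fin.
    apply: le_measure; rewrite ?inE//; first by apply: measurableI => //; exact: measurable_itv.
    exact: measurable_itv.
  by rewrite lebesgue_measure_itv/= lte_fin xi -EFinD -EFinM lee_fin; exact: eK.
rewrite /L1_norm.
under eq_integral => y _.
  rewrite ger0_norm; last first.
    rewrite /piecewise_constant fsumr_ge0// => i _; exact: on_cell_ge0.
  rewrite piecewise_constant_series//; over.
rewrite integral_nneseries//; last 2 first.
- move=> n; apply/measurable_realfun.measurable_EFinP; apply: measurable_realfun.measurable_funD; exact: measurable_on_cell.
- by move=> n y _; rewrite lee_fin addr_ge0// on_cell_ge0.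
apply: lime_le.
  by apply: is_cvg_nneseries => n _ _; apply: integral_ge0 => y _;
    rewrite lee_fin addr_ge0// on_cell_ge0.
apply: nearW => N.
(* t i - t (i - 1) telescopes three steps of the grid at once *)
pose t i := K * (c (x (i + 1)) + c (x i) + c (x (i - 1))).
have step i : (\int[mu]_(y in `[a, b]) (on_cell x e i y)%:E <= (t i - t (i - 1))%:E)%E.
  apply: le_trans (bound i) _; rewrite lee_fin le_eqVlt; apply/orP; left; apply/eqP.
  have -> : t (i - 1) = K * (c (x i) + c (x (i - 1)) + c (x (i - 2))).
    by rewrite /t subrK (_ : i - 1 - 1 = i - 2)//; ring.
  by rewrite /t; ring.
apply: (@le_trans _ _ (\sum_(0 <= n < N) ((t (Posz n) - t (Posz n - 1)) +
    (t (Negz n) - t (Negz n - 1)))%:E)%E).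
  apply: lee_sum => n _.
  under eq_integral do rewrite EFinD.
  rewrite ge0_integralD//; first by rewrite EFinD; apply: leeD.
  - by move=> y _; rewrite lee_fin on_cell_ge0.
  - by apply/measurable_realfun.measurable_EFinP; exact: measurable_on_cell.
  - by move=> y _; rewrite lee_fin on_cell_ge0.
  - by apply/measurable_realfun.measurable_EFinP; exact: measurable_on_cell.
rewrite sumEFin telescope_int lee_fin /t -mulrBr [3 * K]mulrC -mulrA.
apply: ler_wpM2l => //.
set p1 := x _; set p2 := x _; set p3 := x _; set q1 := x _; set q2 := x _; set q3 := x _.
have /andP[+ _] := c_bounds q1; have /andP[+ _] := c_bounds q2.
have /andP[+ _] := c_bounds q3; have /andP[_ +] := c_bounds p1.
have /andP[_ +] := c_bounds p2; have /andP[_ +] := c_bounds p3.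
by rewrite /A /B; lra.
Qed.

End PiecewiseConstant.

(** * The hydrostatic reconstruction scheme *)

Section HydrostaticReconstruction.
Context {R : realType}.
Implicit Types (g v b dt C : R) (V : state R) (x z : int -> R) (U : int -> state R).

(** The support is the open interval with ends [u - sqrt (2 g h)] and
    [u + sqrt (2 g h)], so the bound on its points passes to its ends. *)
Lemma maxwellian_support_speed g v V : 0 < g -> 0 <= v -> 0 < height V ->
  (forall xi, 0 < maxwellian g V xi -> `|xi| <= v) <->
  `|velocity V| + Num.sqrt (2 * g * height V) <= v.
Proof.
move=> g0 v0 h0; set u := velocity V; set k := 2 * g * height V.
have k0 : 0 < k by rewrite /k !mulr_gt0.
have s0 : 0 < Num.sqrt k by rewrite sqrtr_gt0.
have inside xi : (0 < maxwellian g V xi) = (`|xi - u| < Num.sqrt k).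
  by rewrite maxwellian_gt0// -/u -/k -itv_semicircle// ltr_distl.
split => [supp|uv xi]; last first.
  by rewrite inside => hxi; have := lerB_dist xi u; lra.
rewrite leNgt; apply/negP => vu.
(* otherwise a velocity slightly inside the support, on the side of the sign
   of u, has modulus |u| + t > v *)
pose t := (Num.max 0 (v - `|u|) + Num.sqrt k) / 2.
have [t0 ts vt] : [/\ 0 <= t, t < Num.sqrt k & v < `|u| + t].
  by rewrite /t; have [h|h] := leP 0 (v - `|u|); split; lra.
have [u0|u0] := leP 0 u.
  have := supp (u + t); rewrite inside (_ : u + t - u = t); last by ring.
  rewrite ger0_norm// => /(_ ts); rewrite ger0_norm; last lra.
  by rewrite ger0_norm// in vt; lra.
have := supp (u - t); rewrite inside (_ : u - t - u = - t); last by ring.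
rewrite normrN ger0_norm// => /(_ ts); rewrite ler0_norm; last lra.
by rewrite ltr0_norm// in vt; lra.
Qed.

Lemma zhalf_ge_left z i : 0 <= zhalf z i - z i <= `|z (i + 1) - z i|.
Proof.
rewrite /zhalf; have [h|h] := leP (z i) (z (i + 1)); last by rewrite subrr lexx normr_ge0.
by rewrite subr_ge0 h ler_norm.
Qed.

Lemma zhalf_ge_right z i : 0 <= zhalf z (i - 1) - z i <= `|z i - z (i - 1)|.
Proof.
rewrite /zhalf subrK; have [h|h] := leP (z (i - 1)) (z i).
  by rewrite subrr lexx normr_ge0.
by rewrite subr_ge0 ltW// distrC ler_norm.
Qed.

Lemma hminusE z U i :
  hminus z U i = Num.max 0 (height (U i) - (zhalf z i - z i)).
Proof. by rewrite /hminus opprB addrA. Qed.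

Lemma hplusE z U i :
  hplus z U (i - 1) = Num.max 0 (height (U i) - (zhalf z (i - 1) - z i)).
Proof. by rewrite /hplus subrK opprB addrA. Qed.

Lemma height_drop_bounds (h d D : R) : 0 <= h -> 0 <= d <= D ->
  0 <= h - Num.max 0 (h - d) <= D.
Proof. by move=> h0 /andP[d0 dD]; have [?|?] := leP 0 (h - d); apply/andP; lra. Qed.

Lemma hminus_bounds z U i : 0 <= height (U i) ->
  0 <= height (U i) - hminus z U i <= `|z (i + 1) - z i|.
Proof. by move=> h0; rewrite hminusE height_drop_bounds// zhalf_ge_left. Qed.

Lemma hplus_bounds z U i : 0 <= height (U i) ->
  0 <= height (U i) - hplus z U (i - 1) <= `|z i - z (i - 1)|.
Proof. by move=> h0; rewrite hplusE height_drop_bounds// zhalf_ge_right. Qed.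

Lemma Gtilde_kin_entropy_flux g z U i :
  Gtilde g z U i = kin_entropy_flux g (zhalf z i) (Uminus z U i) (Uplus z U i).
Proof. exact: kin_entropy_fluxE. Qed.

Section Setting.
Context {b g v dt : R} {x : int -> R} {U : int -> state R}.
Context (hset : hr_setting b g v x dt U).

Let g0 : 0 < g := gravity_gt0 hset.
Let h0 i : 0 <= height (U i) := height_ge0 hset i.

Lemma dx_gt0 i : 0 < dx x i.
Proof. by rewrite subr_gt0; exact: (grid_increasing hset). Qed.

Lemma sigma_gt0 i : 0 < sigma x dt i.
Proof. by rewrite divr_gt0 ?dx_gt0//; exact: (timestep_gt0 hset). Qed.

Lemma hr_entropy_inequality z U1 i : b < 1 -> hr_scheme g x dt z U U1 ->
  entropy g (U1 i) + g * z i * height (U1 i) <=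
  entropy g (U i) + g * z i * height (U i)
  - sigma x dt i * (Gtilde g z U i - Gtilde g z U (i - 1))
  + quadratic_error (cubic_cst b / 3) g v x dt z U i.
Proof.
move=> b1 /(_ i)[hU1 dU1].
have /andP[dm0 _] := zhalf_ge_left z i.
have /andP[dp0 _] := zhalf_ge_right z i.
have supp j W : velocity W = velocity (U j) -> height W <= height (U j) ->
    forall xi, 0 < maxwellian g W xi -> `|xi| <= v.
  move=> uE hE xi M0; apply: (maxwellian_support hset (i := j)).
  by apply: lt_le_trans M0 _; exact: maxwellian_le.
have hm_le j : hminus z U j <= height (U j).
  by have /andP[] := hminus_bounds z (h0 j); rewrite subr_ge0.
have hp_le j : hplus z U j <= height (U (j + 1)).
  have /andP[] := hplus_bounds z (h0 (j + 1)).
  by rewrite (_ : j + 1 - 1 = j) ?subr_ge0//; ring.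
have := @cell_entropy R g (z i) b v (sigma x dt i) _ _ (U i) (Uminus z U i)
  (Uplus z U (i - 1)) (Uminus z U (i - 1)) (Uplus z U i) (U1 i) g0 b1
  (ltW (sigma_gt0 i)) (cfl hset i) (speed_bound_ge0 hset) (h0 i) dm0 dp0.
rewrite !Gtilde_kin_entropy_flux /quadratic_error.
rewrite (_ : z i + (zhalf z i - z i) = zhalf z i); last by ring.
rewrite (_ : z i + (zhalf z (i - 1) - z i) = zhalf z (i - 1)); last by ring.
apply => //.
- by rewrite /= subrK.
- exact: hminusE.
- exact: hplusE.
- exact: (supp i).
- by apply: (supp (i - 1)) => //; exact: hm_le.
- by apply: (supp (i + 1)) => //; exact: hp_le.
- move: dU1; rewrite /hr_momentum_flux_minus /hr_momentum_flux_plus subrK.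
  exact.
Qed.

Lemma quadratic_error_rate C z i : quadratic_error C g v x dt z U i / dt =
  C * (sigma x dt i * v) * v *
  (g * (height (U i) - hminus z U i) ^+ 2 +
   g * (height (U i) - hplus z U (i - 1)) ^+ 2) / dx x i.
Proof.
have t0 := timestep_gt0 hset; have d0 := dx_gt0 i.
rewrite /quadratic_error /sigma; set E := g * _ + _.
move: (dx x i) E d0 => D E D0; move: dt t0 => T T0.
by field; rewrite !gt_eqF.
Qed.

Lemma quadratic_error_rate_bounds C z i D1 D2 : 0 <= C ->
  `|z (i + 1) - z i| <= D1 -> `|z i - z (i - 1)| <= D2 ->
  0 <= quadratic_error C g v x dt z U i / dt <=
  C * (sigma x dt i * v) * v * (g * D1 ^+ 2 + g * D2 ^+ 2) / dx x i.
Proof.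
move=> C0 z1 z2; rewrite quadratic_error_rate; have d0 := dx_gt0 i.
have /andP[a0 a1] := hminus_bounds z (h0 i).
have /andP[c0 c1] := hplus_bounds z (h0 i).
have v0 := speed_bound_ge0 hset; have s0 := sigma_gt0 i.
have F0 : 0 <= C * (sigma x dt i * v) * v.
  by rewrite mulr_ge0// mulr_ge0// mulr_ge0// ltW.
have gg := ltW g0.
apply/andP; split.
  by rewrite divr_ge0 ?(ltW d0)// mulr_ge0// addr_ge0// mulr_ge0// sqr_ge0.
rewrite ler_pM2r ?invr_gt0//; apply: ler_wpM2l => //.
have D10 : 0 <= D1 by exact: le_trans z1.
have D20 : 0 <= D2 by exact: le_trans z2.
by apply: lerD; apply: ler_wpM2l => //; rewrite lerXn2r ?nnegrE//; lra.
Qed.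

Lemma quadratic_error_flat C z i c : (forall j, z j = c) ->
  quadratic_error C g v x dt z U i / dt = 0.
Proof.
move=> zc; rewrite quadratic_error_rate hminusE hplusE /zhalf !zc !maxxx !subrr !subr0.
by rewrite max_r// subrr expr0n/= mulr0 addr0 mulr0 mul0r.
Qed.

(** The three cells around [i] enter through the two jumps of topography.  One
    factor [sig v] is bounded by the CFL condition, and the other one becomes
    [v] after division by the timestep and multiplication by the length of the
    cell. *)
Lemma lipschitz_quadratic_error C L d (w : R) zf z i : 0 <= C -> 0 <= L ->
  (forall y y', `|zf y - zf y'| <= L * `|y - y'|) -> discretizes zf x z ->
  (forall j, dx x j <= d) -> v <= w ->
  quadratic_error C g v x dt z U i / dt * dx x i <=
  6 * C * b * w * g * L ^+ 2 * d * (x (i + 1) - x (i - 2)).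
Proof.
move=> C0 L0 lip zdisc dxd vw.
have e1 : x (i + 1) - x i <= d by have := dxd (i + 1); rewrite /dx addrK.
have e2 : x i - x (i - 1) <= d by exact: dxd.
have e3 : x (i - 1) - x (i - 2) <= d.
  by have := dxd (i - 1); rewrite /dx (_ : i - 1 - 1 = i - 2)//; ring.
have xh := grid_homo (grid_increasing hset).
have l1 : x (i - 2) <= x (i - 1) by apply: xh; rewrite lerD2l.
have l2 : x i <= x (i + 1) by apply: xh; rewrite lerDl.
have l3 : x (i - 1) <= x i by apply: xh; rewrite gerDl.
set X := x (i + 1) - x (i - 2).
have X0 : 0 <= X by rewrite /X; lra.
have Xd : X <= 3 * d by rewrite /X; lra.
have jump y y' : x (i - 2) <= y <= x (i + 1) -> x (i - 2) <= y' <= x (i + 1) ->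
    `|zf y - zf y'| <= L * X.
  move=> yi yi'; apply: le_trans (lip _ _) _; rewrite ler_wpM2l//.
  by rewrite ler_norml /X; apply/andP; lra.
have [y0 hy0 z0] := zdisc i.
have [y1 hy1 z1] := zdisc (i + 1).
have [y2 hy2 z2] := zdisc (i - 1).
rewrite addrK in hy1; rewrite (_ : i - 1 - 1 = i - 2) in hy2; last by ring.
have D1 : `|z (i + 1) - z i| <= L * X by rewrite z1 z0; apply: jump; apply/andP; lra.
have D2 : `|z i - z (i - 1)| <= L * X by rewrite z2 z0; apply: jump; apply/andP; lra.
have /andP[_] := quadratic_error_rate_bounds C0 D1 D2.
have d0 := dx_gt0 i; rewrite ler_pdivlMr// => /le_trans; apply.
have v0 := speed_bound_ge0 hset; have sv := cfl hset i; have s0 := sigma_gt0 i.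
have sv0 : 0 <= sigma x dt i * v by rewrite mulr_ge0// ltW.
have b0 : 0 <= b by exact: le_trans sv.
have w0 : 0 <= w by exact: le_trans vw.
have gg := ltW g0.
rewrite (_ : g * _ + _ = 2 * g * L ^+ 2 * X * X); last by ring.
rewrite [X in _ <= X](_ : _ = C * b * w * (2 * g * L ^+ 2 * X * (3 * d))); last by ring.
have F0 : 0 <= 2 * g * L ^+ 2 * X by rewrite !mulr_ge0// sqr_ge0.
apply: ler_pM.
- by rewrite mulr_ge0// mulr_ge0.
- by rewrite mulr_ge0.
- by apply: ler_pM => //; [rewrite mulr_ge0|rewrite ler_wpM2l].
- by rewrite ler_wpM2l.
Qed.

End Setting.

End HydrostaticReconstruction.

Theorem corollary3p7 (R : realType) (beta : R) (beta_lt1 : beta < 1) :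
  exists C : R, 0 <= C /\
  [/\ (* the two forms of the condition on vm, for a wet state *)
      forall (g vm : R) (V : state R),
      0 < g -> 0 <= vm -> 0 < height V ->
      ((forall xi : R, 0 < maxwellian g V xi -> `|xi| <= vm) <->
       `|velocity V| + Num.sqrt (2 * g * height V) <= vm),
      (* discrete entropy inequality and bounds on the height differences *)
      forall (g vm : R) (x : int -> R) (dt : R) (z : int -> R)
             (U : int -> state R),
      hr_setting beta g vm x dt U ->
      [/\ forall U1 : int -> state R, hr_scheme g x dt z U U1 ->
          forall i : int,
            entropy g (U1 i) + g * z i * height (U1 i) <=
            entropy g (U i) + g * z i * height (U i)
            - sigma x dt i * (Gtilde g z U i - Gtilde g z U (i - 1))
            + quadratic_error C g vm x dt z U i,
          forall i : int,
            Gtilde g z U i =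
            entropy_flux g (Uminus z U i) (Uplus z U i)
            + g * zhalf z i * mass_flux g (Uminus z U i) (Uplus z U i) &
          forall i : int,
            0 <= height (U i) - hminus z U i <= `|z (i + 1) - z i| /\
            0 <= height (U i) - hplus z U (i - 1) <= `|z i - z (i - 1)|],
      (* no topography *)
      forall (g vm : R) (x : int -> R) (dt : R) (z : int -> R)
             (U : int -> state R),
      hr_setting beta g vm x dt U ->
      (exists c : R, forall i : int, z i = c) ->
      forall i : int, quadratic_error C g vm x dt z U i / dt = 0,
      (* semi-discrete limit *)
      forall (g vm : R) (x : int -> R) (z : int -> R)
             (dt : nat -> R) (U : nat -> int -> state R),
      (forall k : nat, hr_setting beta g vm x (dt k) (U k)) ->
      forall i : int,
      sigma x (dt k) i @[k --> \oo] --> (0 : R) ->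
      quadratic_error C g vm x (dt k) z (U k) i / dt k @[k --> \oo] --> (0 : R) &
      (* strong consistency for a Lipschitz topography *)
      forall (g V : R) (zf : R -> R) (vm : nat -> R)
             (x : nat -> int -> R) (dt : nat -> R) (z : nat -> int -> R)
             (U : nat -> int -> state R),
      lipschitz zf ->
      (forall k : nat, vm k <= V) ->
      (forall k : nat, hr_setting beta g (vm k) (x k) (dt k) (U k)) ->
      (forall k : nat, discretizes zf (x k) (z k)) ->
      mesh_size (x k) @[k --> \oo] --> 0%E ->
      forall a b : R,
      L1_norm a b (piecewise_constant (x k) (fun i : int =>
        quadratic_error C g (vm k) (x k) (dt k) (z k) (U k) i / dt k))
        @[k --> \oo] --> 0%E].
Proof.
exists (cubic_cst beta / 3); split; first by rewrite divr_ge0// cubic_cst_ge0.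
have C0 : 0 <= cubic_cst beta / 3 by rewrite divr_ge0// cubic_cst_ge0.
set C := cubic_cst beta / 3 in C0 *.
split.
- by move=> g vm V; exact: maxwellian_support_speed.
- move=> g vm x dt z U hset; split.
  + by move=> U1 hU1 i; exact: hr_entropy_inequality.
  + by move=> i; rewrite Gtilde_kin_entropy_flux; exact: kin_entropy_flux_split.
  + move=> i; have h0 := height_ge0 hset i.
    by split; [exact: hminus_bounds|exact: hplus_bounds].
- move=> g vm x dt z U hset [c zc] i; exact: (quadratic_error_flat hset).
- move=> g vm x z dt U hset i s0.
  have h0 := hset 0%N.
  pose K := C * vm * vm * (g * `|z (i + 1) - z i| ^+ 2 +
    g * `|z i - z (i - 1)| ^+ 2) / dx x i.
  apply: (@squeeze_cvgr _ _ _ _ (cst 0) (fun k => K * sigma x (dt k) i)).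
  + apply: nearW => k.
    have := quadratic_error_rate_bounds (hset k) C0 (lexx _) (lexx _).
    move=> /(_ z i)/andP[-> /le_trans]; apply => /=.
    by rewrite le_eqVlt; apply/orP; left; apply/eqP; rewrite /K; ring.
  + exact: cvg_cst.
  + by rewrite -(mulr0 K); apply: cvgMr.
- clearbody C; move=> g V zf vm x dt z U lip vV hset zdisc mesh a b.
  have [ba|ab] := ltP b a.
    rewrite /L1_norm set_itv_ge -?leNgt; last by rewrite bnd_simp.
    under eq_fun do rewrite integral_set0.
    exact: cvg_cst.
  have [L L0 lipL] : exists2 L : R, 0 <= L &
      forall y y', `|zf y - zf y'| <= L * `|y - y'|.
    case/pinfty_ex_gt0: lip => L L0 lipL; exists L; first exact: ltW.
    by move=> y y'; exact: (lipL (y, y')).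
  pose d k := fine (mesh_size (x k)).
  have [mfin d_0] := (fine_cvgP _ _).1 mesh.
  pose K := 6 * C * beta * V * g * L ^+ 2.
  apply: (@squeeze_cvge _ _ _ _ (cst 0%E) _
    (fun k => (3 * (K * d k) * (b - a + 4 * d k))%:E)).
  + near=> k.
    have dxd i : dx (x k) i <= d k.
      rewrite -lee_fin /d fineK; last by near: k.
      by apply: ereal_sup_ubound; exists i.
    have e0 i : 0 <= quadratic_error C g (vm k) (x k) (dt k) (z k) (U k) i / dt k.
      by have /andP[] := quadratic_error_rate_bounds (hset k) C0
        (lexx `|z k (i + 1) - z k i|) (lexx `|z k i - z k (i - 1)|).
    have v0 := speed_bound_ge0 (hset k).
    have V0 : 0 <= V by exact: le_trans (vV k).
    have b0 : 0 <= beta.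
      by apply: le_trans (cfl (hset k) 0); rewrite mulr_ge0// ltW// (sigma_gt0 (hset k)).
    have dk0 : 0 <= d k by apply: le_trans (dxd 0); rewrite ltW// (dx_gt0 (hset k)).
    have g0 := ltW (gravity_gt0 (hset k)).
    apply/andP; split; first exact: integral_ge0.
    apply: L1_norm_piecewise_constant_le => //.
    * exact: (grid_increasing (hset k)).
    * apply: mulr_ge0 => //; rewrite /K mulr_ge0 ?sqr_ge0//.
      by rewrite mulr_ge0// mulr_ge0// mulr_ge0// mulr_ge0.
    * by move=> i; apply: (lipschitz_quadratic_error (hset k)).
  + exact: cvg_cst.
  + apply: cvg_EFin; first exact: nearW.
    rewrite (_ : 0 = 3 * (K * 0) * (b - a + 4 * 0)); last by ring.
    apply: cvgM; first by apply: cvgMr; apply: cvgMr.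
    by apply: cvgD; [exact: cvg_cst|exact: cvgMr].
Unshelve. all: by end_near.
Qed.
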